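(* Let $C:[0,\infty)\rightsquigarrow\mathbb{R}^n$ satisfy $(H_C)$ with Lipschitz constant $L_C$ and let $G:[0,\infty)\times\mathbb{R}^n\rightsquigarrow\mathbb{R}^n$ satisfy $(H_G)$ with bound $M$ (assumptions spelled out in the context). Let $K\subseteq\mathbb{R}^n$ be closed and such that $C(t)\cap K\neq\emptyset$ for all $t\ge0$, and set $\mathcal{K}:=[0,\infty)\times K$. Then $\mathcal{K}\cap\mathrm{graph}(C)$ is strongly invariant for the augmented perturbed sweeping process $$\dot\tau(t)=1,\qquad \dot x(t)\in -N_{C(\tau(t))}(x(t))+G(\tau(t),x(t))\ \text{ for a.e. }t>0,\qquad(\tau(0),x(0))=(t_0,x_0)$$ if and only if for every $(\tau,x)\in\mathrm{graph}(C)\cap\mathcal{K}$ one has $$\min_{v\in\{0\}\times(-N_{C(\tau)}(x)\cap(L_C+M)\mathbb{B})}v\cdot p+\max_{v\in\{1\}\times G(\tau,x)}v\cdot p\le0\qquad\forall\,p\in N_{\mathrm{graph}(C)\cap\mathcal{K}}(\tau,x).$$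
   Context: $\mathbb{B}$ is the closed unit ball of $\mathbb{R}^n$; $v\cdot p$ is the Euclidean scalar product. For a set-valued map $F$, $\mathrm{graph}(F)=\{(x,y): y\in F(x)\}$. Proximal normals. For a closed set $A\subset\mathbb{R}^m$ and $x\in A$, the proximal normal cone $N_A(x)$ is the set of $v\in\mathbb{R}^m$ for which there is $\sigma\ge0$ with $v\cdot(y-x)\le\sigma\|y-x\|^2$ for all $y\in A$; $N_A(x)=\emptyset$ if $x\notin A$. Prox-regularity. For $r>0$, a closed set $A$ is $r$-prox-regular if $\zeta\cdot(y-x)\le\frac1{2r}\|\zeta\|\,\|y-x\|^2$ for all $x,y\in A$ and $\zeta\in N_A(x)$. Assumption $(H_C)$: for all $t\ge0$ the set $C(t)$ is nonempty and compact; there is $r>0$ (independent of $t$) such that every $C(t)$ is $r$-prox-regular; and $d_H(C(t),C(s))\le L_C|t-s|$ for all $s,t\ge 0$, with $d_H$ the Hausdorff distance. Assumption $(H_G)$: $G$ has nonempty, closed, convex values; $\|v\|\le M$ for all $v\in G(t,x)$ and all $(t,x)\in[0,\infty)\times\mathbb{R}^n$; $G$ is Lipschitz continuous in $(t,x)$ (for the Hausdorff distance) with constant $L_G$. Solutions are absolutely continuous; along a solution $x(t)\in C(\tau(t))$ for all $t$. Strong invariance: for all $(t_0,x_0)\in\mathrm{graph}(C)\cap\mathcal{K}$, all $T>0$ and every solution $(\tau,x):[0,T]\to\mathbb{R}^{1+n}$ of the Cauchy problem $\dot\tau(t)=1$, $\dot x(t)\in -N_{C(\tau(t))}(x(t))+G(\tau(t),x(t))$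 for a.e. $t\in[0,T]$, $(\tau(0),x(0))=(t_0,x_0)$, one has $(\tau(t),x(t))\in\mathcal{K}\cap\mathrm{graph}(C)$ for all $t\in[0,T]$. *)

(* Defs.v *)
From mathcomp Require Import all_boot all_order all_algebra.
From mathcomp Require Import all_classical all_reals all_analysis.
Set Implicit Arguments.
Unset Strict Implicit.
Unset Printing Implicit Defensive.
Import Order.TTheory GRing.Theory Num.Theory.
Import numFieldNormedType.Exports.
Local Open Scope classical_set_scope.
Local Open Scope ring_scope.

(* The library norm on 'rV[R]_n is the sup norm, hence the explicit Euclidean
   norm; the two induce the same topology, so closed, compact and the
   derivatives below are the library's. *)
Definition dotv (R : realType) n (u v : 'rV[R]_n) : R :=
  \sum_(i < n) u 0 i * v 0 i.

Definition enorm (R : realType) n (v : 'rV[R]_n) : R := Num.sqrt (dotv v v).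

Definition cball (R : realType) n (rho : R) : set 'rV[R]_n :=
  [set v | enorm v <= rho].

(* Computed in \bar R, so that no junk value arises for empty or unbounded
   sets. *)
Definition hausdorff_dist (R : realType) n (A B : set 'rV[R]_n) : \bar R :=
  let excess (A B : set 'rV[R]_n) :=
    ereal_sup [set ereal_inf [set (enorm (a - b))%:E | b in B] | a in A] in
  Order.max (excess A B) (excess B A).

Definition prox_normal (R : realType) n (A : set 'rV[R]_n) (x : 'rV[R]_n) :
    set 'rV[R]_n :=
  [set v | A x /\ exists sigma : R, 0 <= sigma /\
     forall y, A y -> dotv v (y - x) <= sigma * enorm (y - x) ^+ 2].

Definition prox_regular (R : realType) n (r : R) (A : set 'rV[R]_n) : Prop :=
  closed A /\
  forall x y zeta, A x -> A y -> prox_normal A x zeta ->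
    dotv zeta (y - x) <= (2 * r)^-1 * enorm zeta * enorm (y - x) ^+ 2.

(* The point (t, x) of R^(1+n) = R x R^n. *)
Definition tx (R : realType) n (t : R) (x : 'rV[R]_n) : 'rV[R]_(1 + n) :=
  row_mx (const_mx t) x.

Definition prodset (R : realType) n (I : set R) (A : set 'rV[R]_n) :
    set 'rV[R]_(1 + n) :=
  [set tx t x | t in I & x in A].

(* A set-valued map on [0, +oo[ (resp. [0, +oo[ x R^n) is a total function of
   which only the values at times t >= 0 are ever used. *)
Definition graph (R : realType) n (C : R -> set 'rV[R]_n) :
    set 'rV[R]_(1 + n) :=
  [set z | exists t x, [/\ 0 <= t, C t x & z = tx t x]].

Definition H_C (R : realType) n (C : R -> set 'rV[R]_n) (LC : R) : Prop :=
  [/\ forall t, 0 <= t -> C t !=set0 /\ compact (C t),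
      exists2 r : R, 0 < r & forall t, 0 <= t -> prox_regular r (C t) &
      forall t s, 0 <= t -> 0 <= s ->
        (hausdorff_dist (C t) (C s) <= (LC * `|t - s|)%:E)%E].

Definition H_G (R : realType) n (G : R -> 'rV[R]_n -> set 'rV[R]_n)
    (M LG : R) : Prop :=
  [/\ forall t x, 0 <= t ->
        [/\ G t x !=set0, closed (G t x) & convex_set (G t x)],
      forall t x v, 0 <= t -> G t x v -> enorm v <= M &
      forall t s x y, 0 <= t -> 0 <= s ->
        (hausdorff_dist (G t x) (G s y) <=
           (LG * enorm (tx t x - tx s y))%:E)%E].

Definition abs_continuous (R : realType) n (a b : R) (f : R -> 'rV[R]_n) :
    Prop :=
  forall eps : R, 0 < eps -> exists2 delta : R, 0 < delta &
    forall (m : nat) (c d : 'I_m -> R),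
      (forall i, [/\ a <= c i, c i <= d i & d i <= b]) ->
      trivIset setT (fun i => `]c i, d i[%classic) ->
      \sum_(i < m) (d i - c i) < delta ->
      \sum_(i < m) enorm (f (d i) - f (c i)) < eps.

(* tau and x are total functions, but only their restrictions to [0, T]
   matter: the two-sided derivatives at 0 and T, which depend on values
   outside, are ignored by the almost-everywhere quantifier. *)
Definition sweeping_solution (R : realType) n (C : R -> set 'rV[R]_n)
    (G : R -> 'rV[R]_n -> set 'rV[R]_n) (T t0 : R) (x0 : 'rV[R]_n)
    (tau : R -> R) (x : R -> 'rV[R]_n) : Prop :=
  [/\ abs_continuous 0 T (fun t => tx (tau t) (x t)),
      {ae @lebesgue_measure R, forall t : R, t \in `[0, T] ->
        [/\ derivable tau t 1, derive1 tau t = 1, derivable x t 1 &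
            [set - zeta + g | zeta in prox_normal (C (tau t)) (x t)
                            & g in G (tau t) (x t)] (derive1 x t)]},
      forall t : R, t \in `[0, T] -> C (tau t) (x t),
      tau 0 = t0 &
      x 0 = x0].

Definition strongly_invariant (R : realType) n (C : R -> set 'rV[R]_n)
    (G : R -> 'rV[R]_n -> set 'rV[R]_n) (S : set 'rV[R]_(1 + n)) : Prop :=
  forall t0 x0, S (tx t0 x0) -> forall T : R, 0 < T ->
  forall tau x, sweeping_solution C G T t0 x0 tau x ->
  forall t : R, t \in `[0, T] -> S (tx (tau t) (x t)).

Definition is_min (R : realType) (A : set R) (m : R) : Prop :=
  A m /\ lbound A m.

Definition is_max (R : realType) (A : set R) (m : R) : Prop :=
  A m /\ ubound A m.

(* Main.v *)
(** Sufficiency. Along a solution [x] and for [k >= 1], let [V t] be the minimum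
    of [k * (tau - s) ^+ 2 + |x - y| ^+ 2] over the points [(s, y)] of the
    constraint set. At a minimiser, [(k * (tau - s), x - y)] is a proximal normal,
    so the Hamiltonian inequality holds there. Comparing the normals to [C tau] at
    [x] and to [C s] at [y] by prox-regularity costs a quadratic term and a term
    linear in [|tau - s|]; thanks to the weight [k] the linear term is at most
    [c * (V + 1 / k)]. Hence [V' <= c * (V + 1 / k)] almost everywhere, with [c]
    independent of [k], so [V = O(1 / k)], and [x] stays in the closed constraint
    set when [k] tends to infinity.

    Necessity. Let [g0] maximise [g . q] over [G tau x]. The catching-up scheme
    [X_(i+1) = proj_(C t_(i+1)) (X_i + h g_i)], with [g_(i+1)] an element of
    [G t_(i+1) X_(i+1)] close to [g_i], converges (pointwise, along an ultrafilter)
    to a solution issued from [x] whose perturbation starts at [g0]. Inserting this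
    solution in the proximal normal inequality and dividing by the elapsed time,
    the limit points [g0 - zeta] of the mean velocities satisfy
    [p0 + (g0 - zeta) . q <= 0] with [zeta] normal to [C tau] at [x] and
    [|zeta| <= LC + M]. *)

Require Import Defs.
From HB Require Import structures.
From mathcomp Require Import all_boot all_order all_algebra.
From mathcomp Require Import all_classical all_reals all_analysis.
From mathcomp Require Import measurable_realfun ring lra.
Import Order.TTheory GRing.Theory Num.Theory.
Import numFieldNormedType.Exports.
Local Open Scope classical_set_scope.
Local Open Scope ring_scope.

Set Implicit Arguments.
Unset Strict Implicit.

(** * Almost everywhere differentiability of Lipschitz functions *)

(* The Stieltjes measures of [F] and [H] add up to [k] times Lebesgue measure. *)
Lemma stieltjes_dominated (R : realType) (F H : cumulative R R) (k : R) :
  0 < k -> (forall t, F t + H t = k * t) ->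
  lebesgue_stieltjes_measure F `<< @lebesgue_measure R.
Proof.
move=> k0 FH; apply/null_content_dominatesP => A mA A0.
have k'0 : 0 <= k^-1 by rewrite invr_ge0 ltW.
pose m : {measure set (measurableTypeR R) -> \bar R} :=
  mscale (NngNum k'0) (measure_add (lebesgue_stieltjes_measure F)
                                     (lebesgue_stieltjes_measure H)).
have m_E X : m X = (k^-1%:E * (lebesgue_stieltjes_measure F X +
    lebesgue_stieltjes_measure H X))%E.
  rewrite -[LHS]/(k^-1%:E * measure_add (lebesgue_stieltjes_measure F)
    (lebesgue_stieltjes_measure H) X)%E.
  by rewrite measure_addE.
have mE X : ocitv X -> lebesgue_measure X = m X.
  move=> oX; rewrite m_E.
  rewrite /lebesgue_measure /lebesgue_stieltjes_measure /measure_extension/=.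
  rewrite !measurable_mu_extE//=.
  move/ocitvP : oX => [->|[[a b] /= ab ->]]; first by rewrite !wlength0 adde0 mule0.
  rewrite !wlength_itv_bnd ?(ltW ab)//= -EFinD -EFinM; congr (_%:E).
  have := FH a; have := FH b; move: (F a) (F b) (H a) (H b) => fa fb ha hb Eb Ea.
  have -> : fb - fa + (hb - ha) = k * (b - a) by lra.
  by rewrite mulrA mulVf ?mul1r// gt_eqF.
have := lebesgue_stieltjes_measure_unique mE mA.
rewrite -/(@lebesgue_measure R) A0 m_E.
move/esym/eqP; rewrite mule_eq0 /= eqe invr_eq0 gt_eqF//=.
rewrite padde_eq0 ?measure_ge0// => /andP[/eqP + _].
exact.
Qed.

(** Both [f t + L * t] and [- f t + L * t] are nondecreasing and add up to [2 * L * t], so the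
    Stieltjes measure of the first is dominated by Lebesgue measure and has a density. *)
Lemma lipschitz_ae_derivable (R : realType) (f : R -> R) (L : R) :
  (forall s t, `|f s - f t| <= L * `|s - t|) ->
  {ae @lebesgue_measure R, forall t, derivable f t 1}.
Proof.
wlog L0 : L / 0 < L.
  move=> h fL; apply: (h (`|L| + 1)) => [|s t]; first by rewrite ltr_wpDl.
  apply: le_trans (fL s t) _; rewrite ler_wpM2r//.
  by rewrite (le_trans (ler_norm L))// lerDl.
move=> fL.
have cf : continuous f.
  move=> t; apply/cvgrPdist_le => e e0; near=> s.
  apply: le_trans (fL t s) _; rewrite -ler_pdivlMl// mulrC.
  near: s; apply: (@cvgr_dist_le _ _ _ (nbhs t) _ id t) => //.
  by rewrite divr_gt0.
have ndF (g : R -> R) : (forall s t, `|g s - g t| <= L * `|s - t|) ->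
    nondecreasing (fun t => g t + L * t).
  move=> gL s t st; have := gL s t.
  rewrite ler_norml distrC ger0_norm ?subr_ge0// => /andP[_]; lra.
have rcF (g : R -> R) : continuous g -> right_continuous (fun t => g t + L * t).
  move=> cg; apply: right_continuousW => t; apply: cvgD; first exact: cg.
  by apply: cvgM; [exact: cvg_cst|exact: cvg_id].
have NfL s t : `|- f s - - f t| <= L * `|s - t| by rewrite opprK addrC distrC.
have cNf : continuous (fun t => - f t) by move=> t; apply: cvgN; exact: cf.
pose F : cumulative R R := HB.pack (fun t => f t + L * t)
  (isCumulative.Build R _ R (fun t => f t + L * t) (ndF _ fL) (rcF _ cf)).
pose H : cumulative R R := HB.pack (fun t => - f t + L * t)
  (isCumulative.Build R _ R (fun t => - f t + L * t) (ndF _ NfL) (rcF _ cNf)).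
have Fdom : lebesgue_stieltjes_measure F `<< @lebesgue_measure R.
  apply: (@stieltjes_dominated _ F H (2 * L)); first by rewrite mulr_gt0.
  by move=> t; rewrite /F /H /=; lra.
suff FN (N : nat) : {ae @lebesgue_measure R,
    forall t, `|t| < N%:R -> derivable f t 1}.
  have : {ae @lebesgue_measure R, forall t, forall N : nat, `|t| < N%:R -> derivable f t 1}.
    by apply/ae_foralln => N; exact: FN.
  apply: filterS; first exact: (ae_filter_ringOfSetsType (@lebesgue_measure R)).
  move=> t /(_ (Num.truncn `|t|).+1); apply.
  by rewrite truncnS_gt.
have mD : measurable (`](- N%:R), N%:R]%classic : set (measurableTypeR R)) by [].
have muF (a b : R) : a <= b ->
    lebesgue_stieltjes_measure F `]a, b]%classic = (F b - F a)%:E.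
  move=> ab; rewrite /lebesgue_stieltjes_measure /measure_extension.
  rewrite [LHS]measurable_mu_extE/=; first by rewrite wlength_itv_bnd.
  exact: is_ocitv.
have finD : (lebesgue_stieltjes_measure F `](- N%:R)%R, N%:R%R]%classic < +oo)%E.
  by rewrite muF ?ltry// (@le_trans _ _ 0)// oppr_le0.
(* Radon-Nikodym is applied on a bounded interval, where [nu] is finite; by FTC1
   [f] is then locally an affine map plus an indefinite integral. *)
pose nu : {finite_measure set (measurableTypeR R) -> \bar R} := mfrestr mD finD.
have dom : nu `<< @lebesgue_measure R.
  move: Fdom => /null_content_dominatesP Fdom.
  apply/null_content_dominatesP => A mA A0; rewrite /nu /= /mfrestr /mrestr.
  apply: Fdom; first exact: measurableI.
  by apply/eqP; rewrite eq_le measure_ge0 andbT -A0 le_measure// inE//; exact: measurableI.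
have [rho [rho0 rhofin rhoint rhoE]] :=
  @radon_nikodym_sigma_finite _ _ _ (@lebesgue_measure R) nu dom.
pose r t := fine (rho t).
have rE : EFin \o r = rho by apply/funext => t /=; rewrite fineK.
have rint y : (@lebesgue_measure R).-integrable `]-oo, y] (EFin \o r).
  by rewrite rE; apply: integrableS rhoint.
have rloc : locally_integrable [set: R] r.
  by apply: open_integrable_locally; [exact: openT|rewrite rE].
have := FTC1Ny rint rloc; apply: filterS; first exact: (ae_filter_ringOfSetsType (@lebesgue_measure R)).
move=> t [dG _] tN.
pose G := (fun x => (\int[@lebesgue_measure R]_(t in [set` `]-oo, x]]) (r t))%R).
have GE x : `|x| < N%:R -> f x = G x + (F (- N%:R) - L * x).
  rewrite ltr_norml => /andP[Nx xN].
  suff -> : G x = F x - F (- N%:R) by rewrite /F/=; lra.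
  rewrite /G /Rintegral -[RHS]/(fine (_ %:E)) -muF ?(ltW Nx)//; congr fine.
  under eq_integral do rewrite -[_%:E]/((EFin \o r) _) rE.
  rewrite -rhoE// /nu /= /mfrestr /mrestr; congr (lebesgue_stieltjes_measure _ _).
  apply/seteqP; split => [y|y] /=; rewrite !in_itv/=.
    by move=> [yx /andP[-> _]].
  by move=> /andP[-> yx]; rewrite yx (le_trans yx (ltW xN)).
have dR : derivable (G \+ (fun x => F (- N%:R) - L * x)) t 1.
  by apply: derivableD.
apply: (near_eq_derivable _ dR).
near=> x; apply/esym/GE; near: x.
have : open [set x : R | `|x| < N%:R].
  have -> : [set x : R | `|x| < N%:R] = `](- N%:R), N%:R[%classic.
    by apply/seteqP; split => x /=; rewrite in_itv/= ltr_norml.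
  exact: interval_open.
by move=> oN; apply: open_nbhs_nbhs; split.
Unshelve. all: by end_near. Qed.

(** * Absolutely continuous functions with bounded upper derivative *)

Lemma sum_length_disjoint_le (R : realType) (U : set R) (m : nat)
    (c d : 'I_m -> R) :
  measurable U -> (forall i, c i <= d i) ->
  (forall i, `]c i, d i[%classic `<=` U) ->
  trivIset setT (fun i => `]c i, d i[%classic) ->
  ((\sum_(i < m) (d i - c i))%:E <= @lebesgue_measure R U)%E.
Proof.
move=> mU cd cdU tcd.
have mI i : measurable (`]c i, d i[%classic : set (measurableTypeR R)) by [].
have mB : measurable (\big[setU/set0]_(i < m) `]c i, d i[%classic : set (measurableTypeR R)).
  by apply: bigsetU_measurable.
have := measure_semi_additive_ord (@lebesgue_measure R) mI tcd mB.
move=> E; rewrite -sumEFin.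
have -> : (\sum_(i < m) (d i - c i)%:E = \sum_(i < m) @lebesgue_measure R `]c i, d i[%classic)%E.
  apply: eq_bigr => i _; rewrite lebesgue_measure_itv/= lte_fin.
  case: ltgtP (cd i) => // [->] _; by rewrite subrr.
rewrite -E; apply: le_measure; rewrite ?inE//.
by move=> x; rewrite -bigcup_seq => -[i _]; exact: cdU.
Qed.

Definition ac_on (R : realType) (a b : R) (f : R -> R) : Prop :=
  forall eps : R, 0 < eps -> exists2 delta : R, 0 < delta &
    forall (m : nat) (c d : 'I_m -> R),
      (forall i, [/\ a <= c i, c i <= d i & d i <= b]) ->
      trivIset setT (fun i => `]c i, d i[%classic) ->
      \sum_(i < m) (d i - c i) < delta ->
      \sum_(i < m) `|f (d i) - f (c i)| < eps.

(** An upper right Dini bound is all that can be checked for the squared distance to the constraint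
    set, which is a minimum of smooth functions and may have kinks. Absolute continuity makes the
    null set [E] harmless. *)
Lemma dini_le_increment (R : realType) (f : R -> R) (a b B : R) (E : set R) :
  a <= b -> 0 <= B ->
  ac_on a b f ->
  (@lebesgue_measure R).-negligible E ->
  (forall t, a <= t < b -> ~ E t -> forall e, 0 < e ->
    exists2 eta, 0 < eta & forall v, t <= v <= t + eta -> v <= b ->
      f v - f t <= (B + e) * (v - t)) ->
  f b - f a <= B * (b - a).
Proof.
move=> ab B0 fac [N [mN N0 EN]] fdini.
(* Cover [E] by an open set [U] of small measure; the points [v] up to which the
   increment of [f] is bounded, but for its oscillation on finitely many disjoint
   intervals of [U], form an interval that cannot stop before [b]. *)
suff H e : 0 < e -> f b - f a <= (B + e) * (b - a) + e.
  apply/ler_addgt0Pr => e e0.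
  have k0 : 0 < b - a + 1 by rewrite ltr_wpDl// subr_ge0.
  apply: le_trans (H (e / (b - a + 1)) _) _; first by rewrite divr_gt0.
  rewrite mulrDl -addrA lerD2l -{2}(mulr1 (e / _)) -mulrDr.
  by rewrite mulrAC -mulrA divff ?mulr1// gt_eqF.
move=> e0; have [delta delta0 fdelta] := fac e e0.
have [|U [oU NU mUN]] := lebesgue_regularity_outer mN _ delta0.
  by move: N0 => /= ->.
have mU : measurable (U : set (measurableTypeR R)) by exact: open_measurable.
have Udelta : (@lebesgue_measure R U < delta%:E)%E.
  apply: le_lt_trans mUN; rewrite -[leRHS]add0e -[X in (_ <= X + _)%E]N0.
  rewrite -[X in (_ X <= _)%E](setDUK NU); apply: measureU2 => //.
  exact: measurableD.
(* Intervals are listed from right to left, so that a new one ending at [v] goes in front. The slack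
   [e'] in [P] below lets [P] pass to the supremum by continuity of [f]. *)
pose fam v (s : seq (R * R)) :=
  (forall p, p \in s -> [/\ a <= p.1, p.1 <= p.2, p.2 <= v & `]p.1, p.2[%classic `<=` U])
  /\ pairwise (fun p q => q.2 <= p.1) s.
pose vs (s : seq (R * R)) := \sum_(p <- s) `|f p.2 - f p.1|.
pose P v := a <= v <= b /\ forall e', 0 < e' -> exists2 s, fam v s &
  f v - f a <= (B + e) * (v - a) + vs s + e'.
have Be0 : 0 <= B + e by rewrite addr_ge0// ltW.
(* Disjoint intervals inside [U] have total length below [delta], so the oscillation over the whole
   list stays below [e]. *)
have fam_le v s : v <= b -> fam v s -> vs s < e.
  move=> vb [sv ps].
  pose c (i : 'I_(size s)) := (nth (0, 0) s i).1.
  pose d (i : 'I_(size s)) := (nth (0, 0) s i).2.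
  have cdP i : [/\ a <= c i, c i <= d i, d i <= v & `]c i, d i[%classic `<=` U].
    by apply: sv; exact: mem_nth.
  have tcd : trivIset setT (fun i => `]c i, d i[%classic).
    apply/trivIsetP => i j _ _ ij.
    wlog lij : i j ij / (i < j)%N.
      move=> h; move: (ij); rewrite neq_ltn => /orP[|] ?; first exact: h.
      by rewrite setIC; apply: h => //; rewrite eq_sym.
    have dc : d j <= c i.
      by move/(pairwiseP (0, 0)) : ps => /(_ i j); apply; rewrite ?inE.
    rewrite -subset0 => x /= [].
    rewrite !in_itv/= => /andP[+ _] /andP[_ +] => cx xd.
    by have := lt_trans (lt_le_trans xd dc) cx; rewrite ltxx.
  have -> : vs s = \sum_(i < size s) `|f (d i) - f (c i)|.
    by rewrite /vs (big_nth (0, 0)) big_mkord.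
  apply: fdelta => //.
    by move=> i; have [? ? /le_trans ? _] := cdP i; split=> //; auto.
  rewrite -lte_fin; apply: le_lt_trans Udelta.
  by apply: sum_length_disjoint_le => // i; have [] := cdP i.
have fcont e' : 0 < e' -> exists2 d', 0 < d' & forall u v, a <= u -> u <= v -> v <= b ->
    v - u < d' -> `|f v - f u| < e'.
  move=> e'0; have [d' d'0 h] := fac e' e'0; exists d' => // u v au uv vb uvd.
  have := h 1%N (fun=> u) (fun=> v); rewrite !big_ord1; apply => //.
  apply/trivIsetP => i j _ _; by rewrite !ord1 eqxx.
pose A := [set v | P v].
have Aa : A a.
  split; first by rewrite lexx.
  move=> e' e'0; exists [::]; first by split.
  by rewrite /vs big_nil !subrr mulr0 !add0r ltW.
have ubA : ubound A b by move=> v [/andP[]].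
have supA : has_sup A by split; [exists a|exists b].
set z := sup A.
have za : a <= z by apply: sup_upper_bound.
have zb : z <= b by apply: ge_sup => //; exists a.
have fam_le_mono u v s : u <= v -> fam u s -> fam v s.
  move=> uv [h1 h2]; split=> // p ps; have [? ? pu ?] := h1 p ps.
  by split => //; exact: le_trans uv.
have Pz : P z.
  split; first by rewrite za zb.
  move=> e' e'0; have e'20 : 0 < e' / 2 by rewrite divr_gt0.
  have [d' d'0 fd'] := fcont _ e'20.
  have [v Av zv] := sup_adherent d'0 supA.
  have vz : v <= z by exact: sup_upper_bound.
  have [/andP[av vb] /(_ _ e'20)[s sv fs]] := Av.
  exists s; first exact: fam_le_mono sv.
  have : `|f z - f v| < e' / 2 by apply: fd' => //; rewrite -/z in zv; lra.
  move=> /(le_lt_trans (ler_norm _)).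
  have : (B + e) * (v - a) <= (B + e) * (z - a) by rewrite ler_wpM2l// lerD2r.
  lra.
have [zb'|] := ltP z b; last first.
  move=> bz; have zE : z = b by apply/eqP; rewrite eq_le zb bz.
  apply/ler_addgt0Pr => e' e'0; have [_] := Pz; rewrite zE => /(_ _ e'0)[s sb].
  by have := fam_le _ _ (lexx b) sb; lra.
exfalso.
suff [v zv Pv] : exists2 v, z < v & P v.
  by have := sup_upper_bound supA Pv; rewrite -/z leNgt zv.
(* [P] extends beyond [z]: by one more interval of [U] in the list if [z] is in [E], by the Dini
   bound otherwise. *)
have [Ez|nEz] := pselect (E z).
  have [r r0 rU] : exists2 r, 0 < r & ball z r `<=` U.
    have /nbhs_ballP[r /= r0 rU] : nbhs z U.
      by apply: open_nbhs_nbhs; split=> //; apply/NU/EN.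
    by exists r.
  pose v := Num.min b (z + r).
  have zv : z < v by rewrite lt_min zb' ltrDl.
  have vb : v <= b by rewrite ge_min lexx.
  have vr : v <= z + r by rewrite ge_min lexx orbT.
  exists v => //; split; first by rewrite (le_trans za (ltW zv)).
  move=> e' e'0; have [_ /(_ _ e'0)[s [s1 s2] fs]] := Pz.
  exists ((z, v) :: s).
    split.
      move=> p; rewrite inE => /orP[/eqP->/=|/s1[? ? ? ?]].
        split=> //; first exact: ltW.
        move=> x /=; rewrite in_itv/= => /andP[zx xv]; apply: rU.
        rewrite /ball/= distrC ger0_norm ?subr_ge0 ?(ltW zx)//; lra.
      by split=> //; apply: le_trans (ltW zv).
    rewrite /= s2 andbT; apply/allP => p /s1[]//.
  rewrite /vs big_cons/= -/(vs s).
  have := ler_norm (f v - f z).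
  have : (B + e) * (z - a) <= (B + e) * (v - a) by rewrite ler_wpM2l// lerD2r ltW.
  lra.
have [eta eta0 feta] : exists2 eta, 0 < eta & forall v, z <= v <= z + eta -> v <= b ->
      f v - f z <= (B + e) * (v - z).
  by apply: fdini => //; rewrite za zb'.
pose v := Num.min b (z + eta).
have zv : z < v by rewrite lt_min zb' ltrDl.
have vb : v <= b by rewrite ge_min lexx.
have vr : v <= z + eta by rewrite ge_min lexx orbT.
exists v => //; split; first by rewrite (le_trans za (ltW zv)).
move=> e' e'0; have [_ /(_ _ e'0)[s sz fs]] := Pz.
exists s; first by apply: fam_le_mono sz; exact: ltW.
have := feta v; rewrite (ltW zv) vr => /(_ isT vb).
have : (B + e) * (v - a) = (B + e) * (v - z) + (B + e) * (z - a) by rewrite -mulrDr; congr (_ * _); lra.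
lra.
Qed.

(** * Euclidean geometry of row vectors *)

Section euclid.
Context {R : realType} {n : nat}.
Implicit Types (u v w : 'rV[R]_n) (k : R).

Lemma dotvC u v : dotv u v = dotv v u.
Proof. by apply: eq_bigr => i _; rewrite mulrC. Qed.

Lemma dotvDl u v w : dotv (u + v) w = dotv u w + dotv v w.
Proof. by rewrite -big_split/=; apply: eq_bigr => i _; rewrite mxE mulrDl. Qed.

Lemma dotvZl k u v : dotv (k *: u) v = k * dotv u v.
Proof. by rewrite mulr_sumr; apply: eq_bigr => i _; rewrite mxE mulrA. Qed.

Lemma dotvNl u v : dotv (- u) v = - dotv u v.
Proof. by rewrite -scaleN1r dotvZl mulN1r. Qed.

Lemma dotvBl u v w : dotv (u - v) w = dotv u w - dotv v w.
Proof. by rewrite dotvDl dotvNl. Qed.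

Lemma dotvDr u v w : dotv w (u + v) = dotv w u + dotv w v.
Proof. by rewrite dotvC dotvDl !(dotvC w). Qed.

Lemma dotvZr k u v : dotv u (k *: v) = k * dotv u v.
Proof. by rewrite dotvC dotvZl dotvC. Qed.

Lemma dotvNr u v : dotv u (- v) = - dotv u v.
Proof. by rewrite dotvC dotvNl dotvC. Qed.

Lemma dotvBr u v w : dotv w (u - v) = dotv w u - dotv w v.
Proof. by rewrite dotvDr dotvNr. Qed.

Lemma dotv0l v : dotv 0 v = 0.
Proof. by rewrite -(scale0r 0) dotvZl mul0r. Qed.

Lemma dotv0r v : dotv v 0 = 0.
Proof. by rewrite dotvC dotv0l. Qed.

Lemma dotvv_ge0 v : 0 <= dotv v v.
Proof. by apply: sumr_ge0 => i _; rewrite -expr2 sqr_ge0. Qed.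

Lemma enorm_ge0 v : 0 <= enorm v.
Proof. exact: sqrtr_ge0. Qed.
Hint Resolve enorm_ge0 : core.

Lemma sqr_enorm v : enorm v ^+ 2 = dotv v v.
Proof. by rewrite sqr_sqrtr// dotvv_ge0. Qed.

Lemma enormZ k v : enorm (k *: v) = `|k| * enorm v.
Proof.
by rewrite /enorm dotvZl dotvZr mulrA -expr2 sqrtrM ?sqr_ge0// sqrtr_sqr.
Qed.

Lemma enormN v : enorm (- v) = enorm v.
Proof. by rewrite -scaleN1r enormZ normrN1 mul1r. Qed.

Lemma enorm0 : enorm (0 : 'rV[R]_n) = 0.
Proof. by rewrite /enorm dotv0l sqrtr0. Qed.

Lemma edistC u v : enorm (u - v) = enorm (v - u).
Proof. by rewrite -enormN opprB. Qed.

Lemma coord_le_enorm v i : `|v 0 i| <= enorm v.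
Proof.
rewrite -sqrtr_sqr ler_wsqrtr// /dotv (bigD1 i)//= expr2 lerDl.
by apply: sumr_ge0 => j _; rewrite -expr2 sqr_ge0.
Qed.

Lemma enorm_eq0 v : enorm v = 0 -> v = 0.
Proof.
move=> v0; apply/rowP => i; rewrite !mxE; apply/eqP.
by rewrite -normr_le0 -v0 coord_le_enorm.
Qed.

(** Cauchy-Schwarz, by expanding the square of [enorm v *: u - enorm u *: v]. *)
Lemma dotv_le_enorm u v : dotv u v <= enorm u * enorm v.
Proof.
have [/eqP|u0] := eqVneq (enorm u * enorm v) 0.
  rewrite mulf_eq0 => /orP[] /eqP E; rewrite E ?mul0r ?mulr0 (enorm_eq0 E).
    by rewrite dotv0l.
  by rewrite dotv0r.
have uv0 : 0 < enorm u * enorm v by rewrite lt_def u0 mulr_ge0.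
have := dotvv_ge0 (enorm v *: u - enorm u *: v).
rewrite !(dotvBl, dotvBr, dotvZl, dotvZr) -!sqr_enorm (dotvC v u) => h.
rewrite -(ler_pM2l uv0); move: h.
move: (enorm u) (enorm v) (dotv u v) => a b c; lra.
Qed.

Lemma normr_dotv_le u v : `|dotv u v| <= enorm u * enorm v.
Proof.
by rewrite ler_norml dotv_le_enorm andbT lerNl -dotvNl -(enormN u) dotv_le_enorm.
Qed.

Lemma ler_enormD u v : enorm (u + v) <= enorm u + enorm v.
Proof.
rewrite -(@ler_pXn2r _ 2)// ?nnegrE ?addr_ge0//.
rewrite sqr_enorm !(dotvDl, dotvDr) -!sqr_enorm (dotvC v u).
have := dotv_le_enorm u v; rewrite sqrrD; lra.
Qed.

Lemma ler_enormB u v : enorm (u - v) <= enorm u + enorm v.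
Proof. by rewrite -(enormN v) ler_enormD. Qed.

Lemma ler_edistD w u v : enorm (u - v) <= enorm (u - w) + enorm (w - v).
Proof. by rewrite -(subrKA w u (- v)) ler_enormD. Qed.

(** Comparison with the sup norm; the crude factor [n.+1] avoids the square root of [n] and stays
    positive in dimension 0. *)
Lemma enorm_le_coord v e : 0 <= e -> (forall i, `|v 0 i| <= e) ->
  enorm v <= n.+1%:R * e.
Proof.
move=> e0 ve; rewrite -(@ler_pXn2r _ 2)// ?nnegrE ?mulr_ge0//.
rewrite sqr_enorm exprMn; apply: (@le_trans _ _ (\sum_(i < n) e ^+ 2)).
  apply: ler_sum => i _; rewrite -expr2 -real_normK ?num_real//.
  by rewrite ler_pXn2r ?nnegrE.
rewrite sumr_const card_ord -[e ^+ 2 *+ n]mulr_natl ler_wpM2r ?sqr_ge0//.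
by rewrite -natrX ler_nat (leq_trans (leqnSn n))// expnS leq_pmulr// expn_gt0.
Qed.

Lemma nbhs_enormP v (A : set 'rV[R]_n) :
  nbhs v A <-> exists2 e : R, 0 < e & forall u, enorm (v - u) < e -> A u.
Proof.
rewrite -filter_from_ballE; split => -[e /= e0 eA].
  exists e => // u vu; apply: eA; split=> // i j; rewrite ord1.
  apply: le_lt_trans vu; rewrite (le_trans _ (coord_le_enorm _ j))//.
  by rewrite !mxE.
(* Dividing by [n.+2] rather than [n.+1] makes the final inequality strict. *)
exists (e / n.+2%:R); first by rewrite /= divr_gt0.
move=> u [_ vu]; apply: eA.
have d0 : 0 < e / n.+2%:R by rewrite divr_gt0.
apply: (@le_lt_trans _ _ (n.+1%:R * (e / n.+2%:R))).
  apply: enorm_le_coord (ltW d0) _ => i; rewrite !mxE; exact/ltW/vu.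
by rewrite mulrCA gtr_pMr// ltr_pdivrMr// mul1r ltr_nat.
Qed.

Lemma cvg_enormP (T : Type) (F : set_system T) (FF : Filter F)
    (f : T -> 'rV[R]_n) v :
  f @ F --> v <-> forall e, 0 < e -> \forall t \near F, enorm (v - f t) < e.
Proof.
split=> [fv e e0|fv A /nbhs_enormP[e e0 eA]].
  apply: (fv [set u | enorm (v - u) < e]); apply/nbhs_enormP; by exists e.
by apply: filterS (fv e e0) => t /eA.
Qed.

Lemma closed_enormP (A : set 'rV[R]_n) :
  closed A <-> forall v, (forall e, 0 < e -> exists2 u, A u & enorm (v - u) < e) -> A v.
Proof.
split=> [cA v h|h v cv].
  apply: cA => B /nbhs_enormP[e e0 eB]; have [u Au /eB Bu] := h e e0.
  by exists u.
apply: h => e e0; have [|u [Au vu]] := cv [set u | enorm (v - u) < e].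
  by apply/nbhs_enormP; exists e.
by exists u.
Qed.

Lemma compact_enorm (A : set 'rV[R]_n) (B : R) :
  closed A -> (forall u, A u -> enorm u <= B) -> compact A.
Proof.
move=> cA AB; apply: bounded_closed_compact cA; exists B; split.
  exact: num_real.
move=> M BM u /AB uB /=; rewrite [leLHS]/Num.Def.normr/= mx_normrE.
apply: bigmax_le => [|[i j] _ /=].
  by rewrite (le_trans _ (ltW BM))// (le_trans _ uB).
by rewrite ord1 (le_trans (coord_le_enorm u j))// (le_trans uB)// ltW.
Qed.

Section limits.
Context {T : Type} {F : set_system T} {FF : Filter F}.

Lemma cvg_coord (f : T -> 'rV[R]_n) u i :
  f @ F --> u -> (fun t => f t 0 i) @ F --> u 0 i.
Proof.
move=> fu; apply: (@cvg_comp _ _ _ f (fun v => v 0 i) _ _ _ fu).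
exact: (@coord_continuous R 1 n 0 i u).
Qed.

Lemma cvg_dotv (f g : T -> 'rV[R]_n) u v :
  f @ F --> u -> g @ F --> v -> (fun t => dotv (f t) (g t)) @ F --> dotv u v.
Proof.
move=> fu gv; apply: cvg_big => [|i _]; first exact: add_continuous.
by apply: cvgM; exact: cvg_coord.
Qed.

Lemma cvg_enorm (f : T -> 'rV[R]_n) u :
  f @ F --> u -> (fun t => enorm (f t)) @ F --> enorm u.
Proof.
move=> h; apply: (@cvg_comp _ _ _ (fun t => dotv (f t) (f t)) Num.sqrt).
  exact: (cvg_dotv h h).
exact: sqrt_continuous.
Qed.

End limits.

(** Coercivity is only asked on the sublevel set of [f] at [a], which is then compact and contains
    every candidate for the minimum. *)
Lemma min_on_closed (A : set 'rV[R]_n) (f : 'rV[R]_n -> R) (B : R) a :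
  closed A -> A a -> continuous f ->
  (forall u, A u -> f u <= f a -> enorm u <= B) ->
  exists2 u, A u & forall v, A v -> f u <= f v.
Proof.
move=> cA Aa cf fB.
have cf' : closed [set u | f u <= f a].
  by apply: closed_comp (@closed_le R (f a)) => ? _; exact: cf.
have [||u|u] := @compact_EVT_min _ _ f (A `&` [set u | f u <= f a]).
- by exists a; split => /=.
- apply: (@compact_enorm _ B); first exact: closedI.
  by move=> u [] /fB.
- exact: continuous_subspaceT.
rewrite inE => -[Au fua] h; exists u => // v Av.
have [fva|/ltW fav] := leP (f v) (f a); first by apply: h; rewrite inE.
exact: le_trans fua fav.
Qed.

Lemma nearest_point (A : set 'rV[R]_n) z : closed A -> A !=set0 ->
  exists2 u, A u & forall v, A v -> enorm (z - u) <= enorm (z - v).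
Proof.
move=> cA [a Aa].
apply: (@min_on_closed A (fun u => enorm (z - u)) (enorm z + enorm (z - a)) a) => //.
  move=> u; apply: (@cvg_enorm _ (nbhs u) _ (fun v => z - v)).
  by apply: cvgB; [exact: cvg_cst|exact: cvg_id].
move=> u Au h.
by rewrite -(subKr z u) (le_trans (ler_enormB _ _))// lerD2l.
Qed.

Lemma dotv_max_closed (A : set 'rV[R]_n) (B : R) q :
  closed A -> A !=set0 -> (forall u, A u -> enorm u <= B) ->
  exists2 u, A u & forall v, A v -> dotv v q <= dotv u q.
Proof.
move=> cA [a Aa] AB.
have [u Au h] : exists2 u, A u & forall v, A v -> - dotv u q <= - dotv v q.
  apply: (@min_on_closed A (fun u => - dotv u q) B a) => //.
    move=> u; apply: (@cvgN _ _ _ (nbhs u)).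
    by apply: (@cvg_dotv _ (nbhs u)); [exact: cvg_id|exact: cvg_cst].
  by move=> u /AB.
by exists u => // v /h; rewrite lerN2.
Qed.

(** Closedness of [B] makes the distance to [B] attained, so the bound [d] holds for an actual point
    without an additional epsilon. *)
Lemma hausdorff_dist_near (A B : set 'rV[R]_n) d a :
  closed B -> B !=set0 -> (hausdorff_dist A B <= d%:E)%E -> A a ->
  exists2 b, B b & enorm (a - b) <= d.
Proof.
move=> cB B0; rewrite /hausdorff_dist ge_max => /andP[AB _] Aa.
have [b Bb bmin] := nearest_point a cB B0; exists b => //.
rewrite -lee_fin; apply: le_trans AB.
apply: (@le_trans _ _ (ereal_inf [set (enorm (a - b))%:E | b in B])).
  by apply: le_ereal_inf_tmp => _ [v Bv <-]; rewrite lee_fin bmin.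
by apply: ereal_sup_ubound; exists a.
Qed.

(** Expanding the square of [z - v] around [u] leaves half the square of [v - u], hence the constant
    [2^-1]. *)
Lemma proj_prox_normal (A : set 'rV[R]_n) z u :
  A u -> (forall v, A v -> enorm (z - u) <= enorm (z - v)) ->
  prox_normal A u (z - u).
Proof.
move=> Au h; split => //; exists 2^-1; split => [|v Av]; first by rewrite invr_ge0.
have : enorm (z - u) ^+ 2 <= enorm (z - v) ^+ 2.
  by rewrite ler_pXn2r ?nnegrE// h.
rewrite -(subrKA u z (- v)) !sqr_enorm -(opprB v u).
rewrite !(dotvDl, dotvDr, dotvNl, dotvNr) (dotvC v z) (dotvC u z) (dotvC v u).
lra.
Qed.

End euclid.
#[global] Hint Extern 0 (is_true (0 <= enorm _)) => solve [apply: enorm_ge0] : core.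

(** * Points of time-space and their Euclidean norm *)

Section time_space.
Context {R : realType} {n : nat}.
Implicit Types (t s : R) (x y : 'rV[R]_n).

Lemma dotv_tx t s x y : dotv (tx t x) (tx s y) = t * s + dotv x y.
Proof.
rewrite /dotv big_split_ord/= big_ord1 /tx !row_mxEl !mxE; congr (_ + _).
by apply: eq_bigr => i _; rewrite !row_mxEr.
Qed.

Lemma tx_inj t s x y : tx t x = tx s y -> t = s /\ x = y.
Proof. by move=> /eq_row_mx[/matrixP/(_ 0 0)]; rewrite !mxE. Qed.

Lemma tx_sub t s x y : tx t x - tx s y = tx (t - s) (x - y).
Proof.
rewrite /tx opp_row_mx add_row_mx; congr (row_mx _ _).
by apply/matrixP => i j; rewrite !mxE.
Qed.

Lemma txP (z : 'rV[R]_(1 + n)) : exists t x, z = tx t x.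
Proof.
exists (lsubmx z 0 0), (rsubmx z); rewrite -[LHS]hsubmxK; congr (row_mx _ _).
by apply/matrixP => i j; rewrite !mxE !ord1.
Qed.

Lemma sqr_enorm_tx t x : enorm (tx t x) ^+ 2 = t ^+ 2 + enorm x ^+ 2.
Proof. by rewrite !sqr_enorm dotv_tx expr2. Qed.

Lemma enorm_tx_le t x : enorm (tx t x) <= `|t| + enorm x.
Proof.
rewrite -(@ler_pXn2r _ 2)// ?nnegrE ?addr_ge0// ?enorm_ge0//.
rewrite sqr_enorm_tx sqrrD real_normK ?num_real//.
have : 0 <= `|t| * enorm x by rewrite mulr_ge0// enorm_ge0.
lra.
Qed.

Lemma enorm_le_tx t x : enorm x <= enorm (tx t x).
Proof.
by rewrite -(@ler_pXn2r _ 2)// ?nnegrE ?enorm_ge0// sqr_enorm_tx lerDr sqr_ge0.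
Qed.

Lemma normr_le_tx t x : `|t| <= enorm (tx t x).
Proof.
rewrite -(@ler_pXn2r _ 2)// ?nnegrE ?enorm_ge0// sqr_enorm_tx real_normK ?num_real//.
by rewrite lerDl sqr_ge0.
Qed.

End time_space.

(** * Rules for absolutely continuous functions and first-order expansions *)

Section ac.
Context {R : realType}.

Lemma ac_on_dominated n (a b a' b' : R) (F : R -> 'rV[R]_n) (f : R -> R) :
  abs_continuous a b F -> a <= a' -> b' <= b ->
  (forall u v, `|f v - f u| <= enorm (F v - F u)) -> ac_on a' b' f.
Proof.
move=> Fac aa bb fF e e0; have [d d0 h] := Fac e e0; exists d => // m p q pq t s.
apply: le_lt_trans (h m p q _ t s); first by apply: ler_sum.
move=> i; have [? ? ?] := pq i; split => //; first exact: le_trans aa _.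
exact: le_trans bb.
Qed.

Lemma ac_on_lipschitz (a b L : R) (f : R -> R) :
  (forall u v, a <= u -> u <= v -> v <= b -> `|f v - f u| <= L * (v - u)) ->
  ac_on a b f.
Proof.
move=> fL e e0; have L0 : 0 < `|L| + 1 by rewrite ltr_wpDl.
exists (e / (`|L| + 1)) => [|m c d cd _ s]; first by rewrite divr_gt0.
apply: (@le_lt_trans _ _ (\sum_(i < m) (`|L| + 1) * (d i - c i))).
  apply: ler_sum => i _; have [? cdi ?] := cd i.
  apply: le_trans (fL _ _ _ _ _) _ => //; rewrite ler_wpM2r ?subr_ge0//.
  by rewrite (le_trans (ler_norm L))// lerDl.
by rewrite -mulr_sumr mulrC -ltr_pdivlMr.
Qed.

Lemma ac_onD (a b : R) (f g : R -> R) :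
  ac_on a b f -> ac_on a b g -> ac_on a b (fun t => f t + g t).
Proof.
move=> fac gac e e0; have e2 : 0 < e / 2 by rewrite divr_gt0.
have [d1 d10 h1] := fac _ e2; have [d2 d20 h2] := gac _ e2.
exists (Num.min d1 d2) => [|m c d cd tcd]; first by rewrite lt_min d10.
rewrite lt_min => /andP[/(h1 _ _ _ cd tcd) s1 /(h2 _ _ _ cd tcd) s2].
rewrite [ltRHS]splitr; apply: le_lt_trans (ltrD s1 s2).
rewrite -big_split/=; apply: ler_sum => i _.
by rewrite opprD addrACA ler_normD.
Qed.

(** Adding [|B| * t] to [f] makes the slope nonnegative. A negative slope occurs for [- tau], whose
    derivative is [-1]. *)
Lemma ac_dini_le (f : R -> R) (a b B : R) (E : set R) :
  a <= b -> ac_on a b f ->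
  (@lebesgue_measure R).-negligible E ->
  (forall t, a <= t < b -> ~ E t -> forall e, 0 < e ->
    exists2 eta, 0 < eta & forall v, t <= v <= t + eta -> v <= b ->
      f v - f t <= (B + e) * (v - t)) ->
  f b - f a <= B * (b - a).
Proof.
move=> ab fac EN fdini.
suff : (f b + `|B| * b) - (f a + `|B| * a) <= (B + `|B|) * (b - a) by lra.
apply: (@dini_le_increment R (fun t => f t + `|B| * t) _ _ _ E) => //.
- by have := ler_normlW (lexx `|- B|); rewrite normrN; lra.
- apply: ac_onD fac _; apply: (@ac_on_lipschitz _ _ `|B|) => u v _ uv _.
  by rewrite -mulrBr normrM normr_id (ger0_norm (_ : 0 <= v - u))// subr_ge0.
- move=> t tab Et e e0; have [eta eta0 h] := fdini t tab Et e e0.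
  by exists eta => // v tv vb; have := h v tv vb; lra.
Qed.

End ac.

Section derivative_increment.
Context {R : realType}.

Lemma derive1_incr n (x : R -> 'rV[R]_n) t e : derivable x t 1 -> 0 < e ->
  exists2 eta, 0 < eta & forall h, `|h| <= eta ->
    enorm (x (t + h) - x t - h *: derive1 x t) <= e * `|h|.
Proof.
move=> dx e0; have /cvg_enormP/(_ e e0) := dx.
rewrite -[lim _]/('D_1 x t) -derive1E => /nbhs_ballP[d /= d0 hd].
exists (d / 2); first by rewrite divr_gt0.
move=> h hd2; have [->|h0] := eqVneq h 0.
  by rewrite addr0 subrr scale0r subr0 enorm0 normr0 mulr0.
have hltd : ball (0 : R) d h.
  by rewrite /ball/= sub0r normrN (le_lt_trans hd2)// gtr_pMr// invf_lt1// ltr1n.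
have /ltW := hd h hltd h0; rewrite /= -[h%:A]/(h * 1) mulr1 (addrC h).
set D := x (t + h) - x t => hD.
have -> : D - h *: derive1 x t = - h *: (derive1 x t - h^-1 *: D).
  by rewrite scalerBr scalerA mulNr divff// scaleN1r opprK scaleNr addrC.
by rewrite enormZ normrN mulrC ler_wpM2r.
Qed.

Lemma derive1_incr_real (x : R -> R) t e : derivable x t 1 -> 0 < e ->
  exists2 eta, 0 < eta & forall h, `|h| <= eta ->
    `|x (t + h) - x t - h * derive1 x t| <= e * `|h|.
Proof.
move=> dx e0; have /(@cvgrPdist_lt _ R)/(_ e e0) := dx.
rewrite -[lim _]/('D_1 x t) -derive1E => /nbhs_ballP[d /= d0 hd].
exists (d / 2); first by rewrite divr_gt0.
move=> h hd2; have [->|h0] := eqVneq h 0.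
  by rewrite addr0 subrr mul0r subr0 normr0 mulr0.
have hltd : ball (0 : R) d h.
  by rewrite /ball/= sub0r normrN (le_lt_trans hd2)// gtr_pMr// invf_lt1// ltr1n.
have /ltW := hd h hltd h0; rewrite /= -[h%:A]/(h * 1) mulr1 (addrC h).
set D := x (t + h) - x t => hD.
have -> : D - h * derive1 x t = - h * (derive1 x t - h^-1 * D).
  by rewrite mulrBr mulNr mulrA mulNr divff// mulN1r opprK addrC.
by rewrite normrM normrN mulrC ler_wpM2r.
Qed.

End derivative_increment.

(** * Dissipativity of the augmented process *)

Section weighted_projection.
Context {R : realType} {n : nat} (S : set 'rV[R]_(1 + n)).

Lemma ler_sqr_bound (x c : R) : x ^+ 2 <= c -> x <= c + 1.
Proof.
move=> xc; have := sqr_ge0 (x - 1); have := sqr_ge0 x; nra.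
Qed.

Lemma weighted_projection (k t : R) (x : 'rV[R]_n) :
  closed S -> S !=set0 -> 1 <= k ->
  exists w : R * 'rV[R]_n, S (tx w.1 w.2) /\ forall s y, S (tx s y) ->
    k * (t - w.1) ^+ 2 + enorm (x - w.2) ^+ 2 <=
    k * (t - s) ^+ 2 + enorm (x - y) ^+ 2.
Proof.
move=> cS [a Sa] k1.
(* Splitting [k] as [(k - 1) + 1] shows that [f] is at least the squared Euclidean distance to
   [tx t x], which bounds its sublevel sets. *)
pose f (z : 'rV[R]_(1 + n)) :=
  (k - 1) * (t - z 0 (lshift n 0)) ^+ 2 + enorm (tx t x - z) ^+ 2.
have fE s y : f (tx s y) = k * (t - s) ^+ 2 + enorm (x - y) ^+ 2.
  by rewrite /f tx_sub sqr_enorm_tx /tx row_mxEl mxE; lra.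
have [||z Sz hz] := @min_on_closed R (1 + n) S f (enorm (tx t x) + (f a + 1)) a cS Sa.
- move=> z; apply: (@cvgD _ _ _ (nbhs z)).
    apply: (@cvgM _ _ (nbhs z)); first exact: cvg_cst.
    apply: (@cvgM _ _ (nbhs z)).
      by apply: cvgB; [exact: cvg_cst|exact: (@cvg_coord _ _ _ (nbhs z) id)].
    by apply: cvgB; [exact: cvg_cst|exact: (@cvg_coord _ _ _ (nbhs z) id)].
  apply: (@cvgM _ _ (nbhs z));
    apply: (@cvg_enorm _ _ _ (nbhs z) _ (fun v => tx t x - v));
    by apply: cvgB; [exact: cvg_cst|exact: cvg_id].
- move=> u Su fu; rewrite -{1}(subKr (tx t x) u) (le_trans (ler_enormB _ _))// lerD2l.
  apply: ler_sqr_bound; apply: le_trans fu; rewrite /f lerDr.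
  by rewrite mulr_ge0 ?sqr_ge0// subr_ge0.
have [s [y zE]] := txP z; subst z.
by exists (s, y); split=> // s' y' /hz; rewrite !fE.
Qed.

(** The normal is minus half the gradient of the weighted squared distance at the minimiser.
    Expanding minimality leaves half of [k * (s' - s) ^+ 2 + |y' - y| ^+ 2], at most [k] times the
    squared distance because [1 <= k]. *)
Lemma weighted_projection_normal (k t s : R) (x y : 'rV[R]_n) :
  1 <= k -> S (tx s y) -> (forall s' y', S (tx s' y') ->
    k * (t - s) ^+ 2 + enorm (x - y) ^+ 2 <=
    k * (t - s') ^+ 2 + enorm (x - y') ^+ 2) ->
  prox_normal S (tx s y) (tx (k * (t - s)) (x - y)).
Proof.
move=> k1 Ssy hmin; split => //; exists k; split; first by lra.
move=> z; have [s' [y' ->]] := txP z => /hmin.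
rewrite tx_sub dotv_tx sqr_enorm_tx -(subrKA y x (- y')) -(opprB y' y).
rewrite !sqr_enorm !(dotvDl (x - y)) !(dotvDr (x - y)) !dotvNr !dotvNl.
rewrite (dotvC (y' - y) (x - y)).
move: (dotv (x - y) (x - y)) (dotv (x - y) (y' - y)) => a b.
have := dotvv_ge0 (y' - y); move: (dotv (y' - y) (y' - y)) => c c0.
have := sqr_ge0 (s' - s); nra.
Qed.

End weighted_projection.

Section dissipativity.
Context {R : realType} {n : nat}.

Lemma prox_regular_le (r A : R) (D : set 'rV[R]_n) x y zeta :
  0 < r -> prox_regular r D -> prox_normal D x zeta -> enorm zeta <= A -> D y ->
  dotv zeta (y - x) <= A / (2 * r) * enorm (y - x) ^+ 2.
Proof.
move=> r0 [_ hr] Nz zA Dy; have Dx : D x by case: Nz.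
apply: le_trans (hr _ _ _ Dx Dy Nz) _.
rewrite ler_wpM2r ?sqr_ge0// mulrC ler_wpM2r// invr_ge0; lra.
Qed.

(** Prox-regularity only tests points of [D], so [y] is moved to [y'] in [D]. The cost is [d] in the
    distance and [A * d] in the scalar product. This allows comparisons between values of [C] at
    different times. *)
Lemma prox_regular_near_le (r A d : R) (D : set 'rV[R]_n) x y y' zeta :
  0 < r -> prox_regular r D -> prox_normal D x zeta -> enorm zeta <= A ->
  D y' -> enorm (y - y') <= d ->
  dotv zeta (y - x) <= A / (2 * r) * (enorm (y - x) + d) ^+ 2 + A * d.
Proof.
move=> r0 Dr Nz zA Dy' yd.
have d0 : 0 <= d by rewrite (le_trans _ yd).
have A0 : 0 <= A by rewrite (le_trans _ zA).
have -> : dotv zeta (y - x) = dotv zeta (y' - x) + dotv zeta (y - y').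
  by rewrite -dotvDr [in RHS]addrC subrKA.
rewrite lerD//.
  apply: le_trans (prox_regular_le r0 Dr Nz zA Dy') _.
  rewrite ler_wpM2l ?divr_ge0//; first by lra.
  rewrite ler_pXn2r ?nnegrE ?addr_ge0//.
  by rewrite [leRHS]addrC (le_trans (ler_edistD y _ _))// lerD2r edistC.
by apply: le_trans (dotv_le_enorm _ _) _; rewrite ler_pM.
Qed.

(** Here [e] is a gap in time and [q] a distance in space. The term linear in [e] is absorbed by
    [2 * e <= k * e ^+ 2 + k^-1], the others are quadratic; the constant obtained is free of [k]. *)
Lemma drift_le (r A LC LG k e q : R) : 0 < r -> 0 <= A -> 0 <= LC -> 0 <= LG ->
  1 <= k -> 0 <= e -> 0 <= q ->
  2 * (A / (2 * r) * (q + LC * e) ^+ 2 + A * (LC * e)) + LG * (e + q) * q <=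
  (2 * (A / r) * (1 + LC ^+ 2) + A * LC + 2 * LG) * (k * e ^+ 2 + q ^+ 2 + k^-1).
Proof.
move=> r0 A0 LC0 LG0 k1 e0 q0; set V := k * e ^+ 2 + q ^+ 2.
have k0 : 0 < k by lra.
have ki0 : 0 < k^-1 by rewrite invr_gt0.
have eV : e ^+ 2 <= k * e ^+ 2 by rewrite ler_peMl// sqr_ge0.
have V0 : 0 <= V by rewrite addr_ge0 ?mulr_ge0 ?sqr_ge0// ltW.
have e2V : 2 * e <= k * e ^+ 2 + k^-1.
  have : 0 <= k * (e - k^-1) ^+ 2 by rewrite mulr_ge0 ?sqr_ge0// ltW.
  have : k * k^-1 = 1 by rewrite divff// gt_eqF.
  move: k^-1 => i ki; nra.
have h1 : (q + LC * e) ^+ 2 <= 2 * (1 + LC ^+ 2) * V.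
  have := sqr_ge0 (q - LC * e).
  have : LC ^+ 2 * e ^+ 2 <= LC ^+ 2 * (k * e ^+ 2) by rewrite ler_wpM2l// sqr_ge0.
  have : 0 <= LC ^+ 2 * q ^+ 2 by rewrite mulr_ge0 ?sqr_ge0.
  rewrite /V; have := sqr_ge0 e; nra.
have h2 : (e + q) * q <= 2 * V.
  have := sqr_ge0 (e - q); have := sqr_ge0 q; rewrite /V; nra.
have h3 : 2 * e <= V + k^-1 by rewrite /V; have := sqr_ge0 q; lra.
have -> : A / (2 * r) = (A / r) / 2 by rewrite invfM mulrA mulrAC.
have Ar : 0 <= A / r by rewrite divr_ge0// ltW.
have H1 : A / r * (q + LC * e) ^+ 2 <= A / r * (2 * (1 + LC ^+ 2) * V).
  by rewrite ler_wpM2l.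
have H2 : LG * ((e + q) * q) <= LG * (2 * V) by rewrite ler_wpM2l.
have H3 : A * LC * (2 * e) <= A * LC * (V + k^-1) by rewrite ler_wpM2l// mulr_ge0.
have H4 : 0 <= A / r * (1 + LC ^+ 2) * k^-1.
  apply: mulr_ge0 (ltW ki0); apply: mulr_ge0 Ar _.
  by rewrite addr_ge0// sqr_ge0.
have H5 : 0 <= LG * k^-1 by rewrite mulr_ge0// ltW.
move: (A / r) H1 H4 => a; lra.
Qed.

End dissipativity.

(** * Consequences of the hypotheses on the data *)

Section hypotheses.
Context {R : realType} {n : nat}.
Context (C : R -> set 'rV[R]_n) (G : R -> 'rV[R]_n -> set 'rV[R]_n) (LC M LG : R).
Context (K : set 'rV[R]_n).

Lemma H_C_near : H_C C LC -> forall t s x, 0 <= t -> 0 <= s -> C t x ->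
  exists2 y, C s y & enorm (x - y) <= LC * `|t - s|.
Proof.
move=> [C0 [r r0 Cr] CL] t s x t0 s0 Cx.
apply: (hausdorff_dist_near _ _ (CL t s t0 s0)) Cx; first by have [] := Cr s s0.
by have [] := C0 s s0.
Qed.

Lemma H_C_ge0 : H_C C LC -> 0 <= LC.
Proof.
move=> hC; have [C0 _ _] := hC; have [[x Cx] _] := C0 0 (lexx 0).
have [y _] := H_C_near hC (lexx 0) ler01 Cx.
rewrite sub0r normrN normr1 mulr1; exact: le_trans.
Qed.

Lemma H_G_near : H_G G M LG -> forall t s x y g, 0 <= t -> 0 <= s -> G t x g ->
  exists2 g', G s y g' & enorm (g - g') <= LG * enorm (tx (t - s) (x - y)).
Proof.
move=> [G0 GM GL] t s x y g t0 s0 Gg; have := GL t s x y t0 s0; rewrite tx_sub => h.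
by apply: (hausdorff_dist_near _ _ h) Gg; have [] := G0 s y s0.
Qed.

Lemma H_G_ge0 : H_G G M LG -> 0 <= M /\ 0 <= LG.
Proof.
move=> hG; have [G0 GM _] := hG; have [[g Gg] _ _] := G0 0 0 (lexx 0).
split; first exact: le_trans (enorm_ge0 g) (GM _ _ _ (lexx 0) Gg).
have [g' _ h] := H_G_near hG 0 (lexx 0) ler01 Gg.
have : 0 <= LG * enorm (tx (0 - 1) (0 - 0 : 'rV[R]_n)) by rewrite (le_trans _ h).
rewrite pmulr_lge0// (lt_le_trans _ (normr_le_tx _ _))// sub0r normrN normr1.
exact: ltr01.
Qed.

Local Notation S := (graph C `&` prodset [set t : R | 0 <= t] K).

Lemma graph_prodE t x : S (tx t x) <-> [/\ 0 <= t, C t x & K x].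
Proof.
split=> [[[s [y [s0 Cy E]]] [s' _ [y' Ky']]]|[t0 Cx Kx]].
  by rewrite E; have [-> ->] := tx_inj E => /tx_inj[_ Ey]; rewrite Ey in Ky'.
split; first by exists t, x.
by exists t => //; exists x.
Qed.

(** If [(s, y)] in the graph is close to [(t, x)], the Lipschitz property moves [y] into [C t] at
    cost [LC * |t - s|], and [C t] is closed. The tolerance [e / (1 + LC)] covers both
    displacements. *)
Lemma graph_prod_closed : H_C C LC -> closed K -> closed S.
Proof.
move=> hC cK; apply/closed_enormP => z; have [t [x ->]] := txP z => h.
have LC0 := H_C_ge0 hC.
have {}h e : 0 < e -> exists s y, [/\ 0 <= s, C s y, K y, `|t - s| < e & enorm (x - y) < e].
  move=> /h[w]; have [s [y ->]] := txP w => /graph_prodE[s0 Cy Ky].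
  rewrite tx_sub => d; exists s, y; split => //.
    exact: le_lt_trans (normr_le_tx _ _) d.
  exact: le_lt_trans (enorm_le_tx _ _) d.
have t0 : 0 <= t.
  rewrite leNgt; apply/negP => t0; have [|s [y [s0 _ _ ts _]]] := h (- t).
    by rewrite oppr_gt0.
  by move: ts; rewrite distrC ger0_norm; lra.
apply/graph_prodE; split => //.
  have [_ [r _ Cr] _] := hC; have [/closed_enormP + _] := Cr t t0; apply => e e0.
  have d0 : 0 < e / (1 + LC) by rewrite divr_gt0// ltr_wpDr.
  have [s [y [s0 Cy _ ts xy]]] := h _ d0.
  have [y' Cy' yy'] := H_C_near hC s0 t0 Cy; exists y' => //.
  apply: le_lt_trans (ler_edistD y _ _) _.
  have -> : e = e / (1 + LC) + LC * (e / (1 + LC)).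
    by rewrite -[X in X + _]mul1r -mulrDl mulrC divfK// gt_eqF// ltr_wpDr.
  apply: ltr_leD => //; apply: le_trans yy' _; rewrite ler_wpM2l//.
  by rewrite distrC ltW.
move/closed_enormP : cK; apply => e /h[s [y [_ _ Ky _ xy]]]; by exists y.
Qed.

End hypotheses.

(* The constraint is differentiated backwards in time, which gives
   [- dotv zeta w <= LC * enorm zeta] for the velocity [w]. *)
Lemma normal_part_bound (R : realType) (n : nat) (C : R -> set 'rV[R]_n)
    (LC M : R) (tau : R -> R) (x : R -> 'rV[R]_n) (a t : R) (zeta g : 'rV[R]_n) :
  H_C C LC -> a < t -> (forall s, a <= s <= t -> [/\ 0 <= tau s, tau t - tau s = t - s & C (tau s) (x s)]) ->
  derivable x t 1 -> prox_normal (C (tau t)) (x t) zeta -> derive1 x t = - zeta + g ->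
  enorm g <= M -> enorm zeta <= LC + M.
Proof.
move=> hC at_ xC dx [_ [sg [sg0 hz]]] xE gM; have LC0 := H_C_ge0 hC.
set w := derive1 x t in xE.
have key : - dotv zeta w <= LC * enorm zeta.
  apply/ler_addgt0Pr => e e0.
  (* After division by [h] the error is at most [d * k]: the remainder of the derivative contributes
     [enorm zeta], the quadratic term of the normal inequality the second summand, and [1] ensures
     positivity. *)
  pose k := enorm zeta + sg * (LC + 1 + enorm w) ^+ 2 + 1.
  have k0 : 0 < k by rewrite /k ltr_wpDl// addr_ge0// mulr_ge0// sqr_ge0.
  pose d := Num.min 1 (e / k).
  have d0 : 0 < d by rewrite lt_min ltr01 divr_gt0.
  have d1 : d <= 1 by rewrite ge_min lexx.
  have de : d * k <= e by rewrite -ler_pdivlMr// ge_min lexx orbT.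
  have [eta eta0 hx] := derive1_incr dx d0.
  pose h := Num.min d (Num.min eta (t - a)).
  have h0 : 0 < h by rewrite lt_min d0 lt_min eta0 subr_gt0.
  have hd : h <= d by rewrite ge_min lexx.
  have heta : h <= eta by rewrite !ge_min lexx orbT.
  have hta : h <= t - a by rewrite !ge_min lexx !orbT.
  have := hx (- h); rewrite normrN (gtr0_norm h0) -/w scaleNr opprK => /(_ heta) hw.
  have [|th0 thE Cth] := xC (t - h); first by lra.
  have [|t0 _ Ct] := xC t; first by lra.
  have [y Cy] := H_C_near hC th0 t0 Cth.
  rewrite distrC thE (_ : t - (t - h) = h) ?(gtr0_norm h0)//; last by lra.
  move=> xy; have := hz _ Cy.
  set D := x (t - h) - x t + h *: w in hw.
  have E : y - x t = D - h *: w - (x (t - h) - y).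
    by rewrite /D addrK opprB [RHS]addrC subrKA.
  have yx : enorm (y - x t) <= h * (LC + 1 + enorm w).
    rewrite E; apply: le_trans (ler_enormB _ _) _.
    have := ler_enormB D (h *: w); rewrite enormZ (gtr0_norm h0).
    have : d * h <= h by rewrite ler_piMl// ltW.
    lra.
  have yx2 : enorm (y - x t) ^+ 2 <= h * (d * (LC + 1 + enorm w) ^+ 2).
    apply: (@le_trans _ _ ((h * (LC + 1 + enorm w)) ^+ 2)).
      by rewrite ler_pXn2r ?nnegrE// mulr_ge0 ?(ltW h0)// !addr_ge0.
    by rewrite exprMn expr2 -mulrA ler_wpM2l ?(ltW h0)// ler_wpM2r// sqr_ge0.
  have := ler_wpM2l sg0 yx2.
  rewrite E !dotvBr dotvZr => H1 H2.
  have H3 := dotv_le_enorm zeta (x (t - h) - y).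
  have H4 : enorm zeta * enorm (x (t - h) - y) <= enorm zeta * (LC * h) by rewrite ler_wpM2l.
  have := normr_dotv_le zeta D; rewrite ler_norml => /andP[H5 _].
  have H6 : enorm zeta * enorm D <= enorm zeta * (d * h) by rewrite ler_wpM2l.
  have : h * (- dotv zeta w) <= h * (enorm zeta * LC + d * k).
    rewrite dotvBr in H3; have := mulr_gt0 d0 h0; rewrite /k; lra.
  rewrite ler_pM2l//; lra.
(* Substituting [w = - zeta + g] in [key] turns [- dotv zeta w] into the square of [enorm zeta]
   minus [dotv zeta g]. *)
have : enorm zeta * enorm zeta <= enorm zeta * (LC + M).
  have := dotv_le_enorm zeta g; have := ler_wpM2l (enorm_ge0 zeta) gM.
  move: key; rewrite xE dotvDr dotvNr -sqr_enorm; lra.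
have [->|z0] := eqVneq (enorm zeta) 0.
  by move=> _; rewrite addr_ge0// (le_trans _ gM).
by rewrite ler_pM2l// lt_def z0 /=.
Qed.

(** * Sufficiency *)

Lemma negligible_set1 (R : realType) (a : R) :
  (@lebesgue_measure R).-negligible [set a].
Proof. by exists [set a]; split => //; exact: lebesgue_measure_set1. Qed.

Section sufficiency.
Context {R : realType} {n : nat}.
Context (C : R -> set 'rV[R]_n) (G : R -> 'rV[R]_n -> set 'rV[R]_n) (LC M LG : R).
Context (K : set 'rV[R]_n).
Hypotheses (hC : H_C C LC) (hG : H_G G M LG).

(** Information valid almost everywhere is integrated with [ac_dini_le]. The Lipschitz constant adds
    the bound [LC + M] on the normal part of the velocity to the bound [M] on the perturbation. *)
Lemma solution_regular T t0 x0 tau x : 0 < T -> 0 <= t0 ->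
  sweeping_solution C G T t0 x0 tau x ->
  exists E, [/\ (@lebesgue_measure R).-negligible E,
    forall t, 0 <= t <= T -> tau t = t0 + t,
    forall u v, 0 <= u -> u <= v -> v <= T ->
      enorm (x v - x u) <= (LC + M + M) * (v - u) &
    forall t, 0 < t < T -> ~ E t -> exists zeta g,
      [/\ derivable x t 1, prox_normal (C (t0 + t)) (x t) zeta,
          G (t0 + t) (x t) g, derive1 x t = - zeta + g & enorm zeta <= LC + M]].
Proof.
move=> T0 t00 [ac [E0 [mE0 E00 E0P]] xC tau0 x0E].
(* Time 0 is exceptional because the bound on the normal part looks backwards in time. *)
pose E := E0 `|` [set 0].
have EN : (@lebesgue_measure R).-negligible E.
  apply: negligibleU; first by exists E0; split.
  exact: negligible_set1.
have good t : 0 <= t <= T -> ~ E t -> 0 < t /\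
    [/\ derivable tau t 1, derive1 tau t = 1, derivable x t 1 &
            [set - zeta + g | zeta in prox_normal (C (tau t)) (x t)
                            & g in G (tau t) (x t)] (derive1 x t)].
  move=> tT Et; split.
    have [t0_ _] := andP tT; rewrite lt_def t0_ andbT; apply/eqP => tz.
    by apply: Et; right.
  apply: contrapT => nP; apply: Et; left; apply: E0P => /= h; apply: nP.
  by apply: h; rewrite in_itv.
have acd b f : b <= T -> (forall u v, `|f v - f u| <=
    enorm (tx (tau v) (x v) - tx (tau u) (x u))) -> ac_on 0 b f.
  by move=> bT; apply: ac_on_dominated ac _ bT.
have tauE t : 0 <= t <= T -> tau t = t0 + t.
  move=> /andP[t_0 tT].
  have H1 : tau t - tau 0 <= 1 * (t - 0).
    apply: (@ac_dini_le _ tau 0 t 1 E) => //.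
      by apply: acd => // u v; rewrite tx_sub normr_le_tx.
    move=> s /andP[s0 st] Es e e0.
    have [|s0' [dt dt1 _ _]] := good s _ Es; first by rewrite s0; lra.
    have [eta eta0 h] := derive1_incr_real dt e0; exists eta => // v /andP[sv vs] _.
    have := h (v - s); rewrite (ger0_norm (_ : 0 <= v - s)) ?subr_ge0//.
    rewrite dt1 mulr1 (_ : s + (v - s) = v); last by lra.
    rewrite lerBlDl => /(_ vs); rewrite ler_norml => /andP[_]; lra.
  have H2 : - tau t - - tau 0 <= (-1) * (t - 0).
    apply: (@ac_dini_le _ (fun t => - tau t) 0 t (-1) E) => //.
      by apply: acd => // u v; rewrite tx_sub -opprD normrN normr_le_tx.
    move=> s /andP[s0 st] Es e e0.
    have [|s0' [dt dt1 _ _]] := good s _ Es; first by rewrite s0; lra.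
    have [eta eta0 h] := derive1_incr_real dt e0; exists eta => // v /andP[sv vs] _.
    have := h (v - s); rewrite (ger0_norm (_ : 0 <= v - s)) ?subr_ge0//.
    rewrite dt1 mulr1 (_ : s + (v - s) = v); last by lra.
    rewrite lerBlDl => /(_ vs); rewrite ler_norml => /andP[+ _]; lra.
  rewrite tau0 in H1 H2; lra.
have M0 : 0 <= M by have [] := H_G_ge0 hG.
have LC0 := H_C_ge0 hC.
have goodx t : 0 < t < T -> ~ E t -> exists zeta g,
      [/\ derivable x t 1, prox_normal (C (t0 + t)) (x t) zeta,
          G (t0 + t) (x t) g, derive1 x t = - zeta + g & enorm zeta <= LC + M].
  move=> /andP[t_0 tT] Et; have [|_ [_ _ dx]] := good t _ Et; first by rewrite !ltW.
  have tT' : 0 <= t <= T by rewrite !ltW.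
  rewrite tauE// => -[zeta Nz [g Gg xE]]; exists zeta, g; split => //.
  apply: (@normal_part_bound R n C LC M tau x 0 t zeta g) => //.
  - move=> s /andP[s0 st]; have sT : 0 <= s <= T by rewrite s0; lra.
    rewrite !tauE//; split; [by lra|by lra|].
    by rewrite -tauE//; apply: xC; rewrite in_itv.
  - by rewrite tauE.
  - have [_ GM _] := hG; apply: (GM (t0 + t) (x t) g) => //; lra.
exists E; split => // u v u0 uv vT.
(* The distance to the fixed point [x u] vanishes at [u] and grows at most at the speed of [x]. *)
have := @ac_dini_le _ (fun t => enorm (x t - x u)) u v (LC + M + M) E.
rewrite subrr enorm0 subr0; apply => //.
  apply: ac_on_dominated ac u0 vT _ => s t; rewrite tx_sub.
  apply: le_trans (enorm_le_tx _ _).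
  rewrite ler_norml; apply/andP; split.
    have := ler_edistD (x t) (x s) (x u); rewrite (edistC (x s) (x t)); lra.
  have := ler_edistD (x s) (x t) (x u); lra.
move=> t /andP[ut tv] Et e e0.
have [|t_0 _] := good t _ Et; first by apply/andP; split; lra.
have [|zeta [g [dx Nz Gg xE zA]]] := goodx t _ Et; first by rewrite t_0; lra.
have [eta eta0 h] := derive1_incr dx e0; exists eta => // w /andP[tw wt] _.
have := h (w - t); rewrite (ger0_norm (_ : 0 <= w - t)) ?subr_ge0//.
rewrite (_ : t + (w - t) = w); last by lra.
rewrite lerBlDl => /(_ wt) hw.
have := ler_edistD (x t) (x w) (x u).
have -> : x w - x t = (x w - x t - (w - t) *: derive1 x t) + (w - t) *: derive1 x t.
  by rewrite subrK.
have := ler_enormD (x w - x t - (w - t) *: derive1 x t) ((w - t) *: derive1 x t).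
rewrite enormZ (ger0_norm (_ : 0 <= w - t)) ?subr_ge0//.
have : (w - t) * enorm (derive1 x t) <= (w - t) * (LC + M + M).
  rewrite ler_wpM2l ?subr_ge0// xE addrC (le_trans (ler_enormB _ _))// addrC lerD//.
  have [_ GM _] := hG; apply: (GM (t0 + t) (x t) g) => //; lra.
lra.
Qed.

Hypothesis hK : closed K.
Local Notation S := (graph C `&` prodset [set t : R | 0 <= t] K).
Hypothesis hcond : forall (tau : R) (x : 'rV[R]_n), S (tx tau x) ->
   forall p : 'rV[R]_(1 + n), prox_normal S (tx tau x) p ->
   exists mn mx : R,
     [/\ is_min [set dotv v p | v in prodset [set (0 : R)]
            ([set - zeta | zeta in prox_normal (C tau) x] `&`
             cball (LC + M))] mn,
         is_max [set dotv v p | v in prodset [set (1 : R)] (G tau x)] mx &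
         mn + mx <= 0].

(** The left-hand side is half the derivative of the weighted squared distance along a solution,
    with the minimiser frozen. The Hamiltonian inequality at [(s, y)] controls it up to the change
    of normal and of perturbation between [(t, x)] and [(s, y)]. The constant is chosen before
    [k]. *)
Lemma drift_constant : exists2 c, 0 <= c &
  forall k t x s y zeta g, 1 <= k -> 0 <= t -> S (tx s y) ->
  (forall s' y', S (tx s' y') ->
    k * (t - s) ^+ 2 + enorm (x - y) ^+ 2 <=
    k * (t - s') ^+ 2 + enorm (x - y') ^+ 2) ->
  prox_normal (C t) x zeta -> enorm zeta <= LC + M -> G t x g ->
  k * (t - s) + dotv (- zeta + g) (x - y) <=
  c * (k * (t - s) ^+ 2 + enorm (x - y) ^+ 2 + k^-1).
Proof.
have [M0 LG0] := H_G_ge0 hG; have LC0 := H_C_ge0 hC.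
have [_ [r r0 Cr] _] := hC.
have A0 : 0 <= LC + M by rewrite addr_ge0.
exists (2 * ((LC + M) / r) * (1 + LC ^+ 2) + (LC + M) * LC + 2 * LG).
  have : 0 <= (LC + M) / r by rewrite divr_ge0// ltW.
  have : 0 <= 1 + LC ^+ 2 by rewrite addr_ge0// sqr_ge0.
  by move: (_ / r) (_ + LC ^+ 2) => a b b0 a0; rewrite !addr_ge0// !mulr_ge0.
move=> k t x s y zeta g k1 t0 Ssy hmin Nz zA Gg.
have [s0 Cy Ky] := (graph_prodE C K s y).1 Ssy.
have [mn [mx [[[v [_ [/= -> [w [[zeta' Nz' <-] zA'] <-]]]] mnE _] [_ mxub] mnmx]]] :=
  hcond Ssy (weighted_projection_normal k1 Ssy hmin).
have Cx : C t x by case: Nz.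
have [y' Cy' yy'] := H_C_near hC s0 t0 Cy.
have [x' Cx' xx'] := H_C_near hC t0 s0 Cx.
have [g' Gg' gg'] := H_G_near hG y t0 s0 Gg.
(* The minimum is attained at [- zeta'], and the maximum dominates the value at [g'], the element of
   [G s y] close to [g]. *)
have H0 : k * (t - s) - dotv zeta' (x - y) + dotv g' (x - y) <= 0.
  have E1 : mn = - dotv zeta' (x - y) by rewrite -mnE dotv_tx mul0r add0r dotvNl.
  have : k * (t - s) + dotv g' (x - y) <= mx.
    rewrite -[k * _]mul1r -dotv_tx; apply: mxub.
    exists (tx 1 g') => //; exists 1 => //; by exists g'.
  lra.
have zA'' : enorm zeta' <= LC + M by rewrite -enormN.
(* Each normal is tested against the other base point, moved into its own set; the sum bounds
   [dotv (zeta' - zeta) (x - y)]. *)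
have H1 := prox_regular_near_le r0 (Cr t t0) Nz zA Cy' yy'.
have H2 := prox_regular_near_le r0 (Cr s s0) Nz' zA'' Cx' xx'.
have H3 := drift_le r0 A0 LC0 LG0 k1 (normr_ge0 (t - s)) (enorm_ge0 (x - y)).
rewrite real_normK ?num_real// in H3.
apply: le_trans H3.
have H4 : dotv (g - g') (x - y) <= LG * (`|t - s| + enorm (x - y)) * enorm (x - y).
  apply: le_trans (dotv_le_enorm _ _) _; rewrite ler_wpM2r//.
  by apply: le_trans gg' _; rewrite ler_wpM2l// enorm_tx_le.
rewrite dotvDl dotvNl; rewrite dotvBl in H4.
rewrite -(opprB x y) dotvNr enormN distrC in H1.
lra.
Qed.

End sufficiency.

Section sufficiency.
Context {R : realType} {n : nat}.
Context (C : R -> set 'rV[R]_n) (G : R -> 'rV[R]_n -> set 'rV[R]_n) (LC M LG : R).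
Context (K : set 'rV[R]_n).
Hypotheses (hC : H_C C LC) (hG : H_G G M LG).

Hypothesis hK : closed K.
Local Notation S := (graph C `&` prodset [set t : R | 0 <= t] K).
Hypothesis hcond : forall (tau : R) (x : 'rV[R]_n), S (tx tau x) ->
   forall p : 'rV[R]_(1 + n), prox_normal S (tx tau x) p ->
   exists mn mx : R,
     [/\ is_min [set dotv v p | v in prodset [set (0 : R)]
            ([set - zeta | zeta in prox_normal (C tau) x] `&`
             cball (LC + M))] mn,
         is_max [set dotv v p | v in prodset [set (1 : R)] (G tau x)] mx &
         mn + mx <= 0].

(** On an interval of length [h] starting in the constraint set, a bound [m] of [V] improves to
    [(m + k^-1) / 2]; the supremum of [V] is therefore at most [k^-1], which takes the place of a
    Gronwall inequality. The length [h] depends neither on [k] nor on [a]. *)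
Lemma invariance_step T t0 x0 tau x : 0 < T -> S (tx t0 x0) ->
  sweeping_solution C G T t0 x0 tau x ->
  exists2 h, 0 < h & forall a, 0 <= a -> S (tx (tau a) (x a)) ->
    forall t, a <= t <= a + h -> t <= T -> S (tx (tau t) (x t)).
Proof.
move=> T0 S0 sol; have [t00 _ _] := (graph_prodE C K t0 x0).1 S0.
have [E [EN tauE xL good]] := solution_regular hC hG T0 t00 sol.
have [c c0 drift] := drift_constant hC hG hcond.
have [M0 LG0] := H_G_ge0 hG; have LC0 := H_C_ge0 hC.
set L := LC + M + M in xL.
have L0 : 0 <= L by rewrite !addr_ge0.
have cS := graph_prod_closed hC hK.
(* Since [V] grows at rate at most [2 * c * (m + k^-1)], the inequality [4 * c * h <= 1] produces
   the factor one half. *)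
pose h := (4 * c + 1)^-1.
have h0 : 0 < h by rewrite invr_gt0; lra.
have hc : 4 * c * h <= 1.
  by rewrite -ler_pdivlMr// div1r invrK lerDl.
exists h => // a a0 Sa b1 /andP[ab1 b1h] b1T.
move/closed_enormP : (cS); apply => e e0.
pose k := 1 + e ^- 2.
have e2 : 0 < e ^- 2 by rewrite invr_gt0 exprn_gt0.
have k1 : 1 <= k by rewrite lerDl ltW.
have k0 : 0 < k by lra.
have ke : k^-1 < e ^+ 2.
  by rewrite -[ltRHS]invrK ltf_pV2 ?posrE// ltrDr.
clearbody k; clear e2.
pose phi t (w : R * 'rV[R]_n) := k * (tau t - w.1) ^+ 2 + enorm (x t - w.2) ^+ 2.
have exW t : exists w : R * 'rV[R]_n, S (tx w.1 w.2) /\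
    forall s y, S (tx s y) -> phi t w <= phi t (s, y).
  by apply: weighted_projection => //; exists (tx t0 x0).
have [W WP] := choice exW; pose V t := phi t (W t).
have V0 t : 0 <= V t.
  by rewrite addr_ge0 ?sqr_ge0// mulr_ge0 ?sqr_ge0 ?(ltW k0).
(* Exact second-order expansion in time with the point [w] frozen. *)
have phiD u v w : 0 <= u <= T -> 0 <= v <= T -> phi v w - phi u w =
    (v - u) * (2 * (k * (tau u - w.1))) + 2 * dotv (x v - x u) (x u - w.2)
    + (k * (v - u) ^+ 2 + enorm (x v - x u) ^+ 2).
  move=> uT vT; rewrite /phi !tauE// -(subrKA (x u) (x v) (- w.2)).
  move: (x v - x u) (x u - w.2) => p q.
  by rewrite !sqr_enorm dotvDl !dotvDr (dotvC q); ring.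
have abT t : a <= t <= b1 -> 0 <= t <= T by lra.
have VleW t u : V t <= phi t (W u).
  have [+ _] := WP u; have [_ +] := WP t; move=> /(_ (W u).1 (W u).2) + /[dup] => + _.
  by move=> h1 /h1; rewrite -surjective_pairing.
have Va : V a = 0.
  apply/eqP; rewrite eq_le V0 andbT; have [_ /(_ _ _ Sa)] := WP a.
  by rewrite /phi/= !subrr enorm0 expr0n/= mulr0 addr0.
(* A priori bound of [V], by comparison with the point of the constraint set occupied at time [a].
   It depends on [k] and only serves to make [V] Lipschitz and its supremum finite. *)
pose m0 := (k + L ^+ 2) * (b1 - a) ^+ 2.
have Vm0 t : a <= t <= b1 -> V t <= m0.
  move=> tab; have [_ /(_ _ _ Sa)] := WP t => /le_trans; apply.
  have tT' := abT _ tab.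
  have aT' : 0 <= a <= T by rewrite a0; lra.
  rewrite /phi/= !tauE//.
  have [at_ tb] := andP tab.
  have tT := le_trans tb b1T.
  have xx : enorm (x t - x a) ^+ 2 <= (L * (t - a)) ^+ 2.
    by rewrite ler_pXn2r ?nnegrE// ?xL// mulr_ge0// subr_ge0.
  have tb2 : (t - a) ^+ 2 <= (b1 - a) ^+ 2.
    by rewrite ler_pXn2r ?nnegrE ?subr_ge0// lerD2r.
  have : (k + L ^+ 2) * (t - a) ^+ 2 <= m0.
    by rewrite ler_wpM2l// addr_ge0 ?sqr_ge0 ?(ltW k0).
  rewrite (_ : t0 + t - (t0 + a) = t - a); last by lra.
  move: xx; rewrite exprMn; lra.
have W1 t : a <= t <= b1 -> `|tau t - (W t).1| <= m0 + 1.
  move=> /Vm0 Vt; apply: ler_sqr_bound; rewrite real_normK ?num_real//.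
  apply: le_trans Vt; rewrite /V /phi; have := sqr_ge0 (tau t - (W t).1).
  have := sqr_ge0 (enorm (x t - (W t).2)); nra.
have W2 t : a <= t <= b1 -> enorm (x t - (W t).2) <= m0 + 1.
  move=> /Vm0 Vt; apply: ler_sqr_bound.
  by apply: le_trans Vt; rewrite /V /phi lerDr mulr_ge0 ?sqr_ge0 ?(ltW k0).
have Vac b : b <= b1 -> ac_on a b V.
  move=> bb; pose B := 2 * k * (m0 + 1) + 2 * L * (m0 + 1) + (k + L ^+ 2) * T.
  have key u v : a <= u <= b1 -> a <= v <= b1 -> V v - V u <= B * `|v - u|.
    move=> uab vab; apply: (@le_trans _ _ (phi v (W u) - phi u (W u))).
      by rewrite lerD2r.
    have [uT vT] := (abT _ uab, abT _ vab); rewrite phiD//.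
    have xvu : enorm (x v - x u) <= L * `|v - u|.
      case/andP: (uT) (vT) => u0 uT' /andP[v0 vT']; case: (leP u v) => uv.
        by rewrite (ger0_norm (_ : 0 <= v - u)) ?subr_ge0// xL.
      by rewrite edistC distrC (ger0_norm (_ : 0 <= u - v)) ?subr_ge0 ?(ltW uv)// xL// ltW.
    have vuT : `|v - u| <= T by rewrite ler_norml; have := abT _ uab; have := abT _ vab; lra.
    have := normr_ge0 (v - u); rewrite -(real_normK (num_real (v - u))).
    have T1 : (v - u) * (2 * (k * (tau u - (W u).1))) <= `|v - u| * (2 * k * (m0 + 1)).
      apply: le_trans (ler_norm _) _; rewrite !normrM (ger0_norm (_ : 0 <= 2))// (gtr0_norm k0) mulrA.
      rewrite -!mulrA ler_wpM2l// ler_wpM2l// ler_wpM2l ?(ltW k0)//; exact: W1.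
    have T2 : dotv (x v - x u) (x u - (W u).2) <= L * `|v - u| * (m0 + 1).
      apply: le_trans (dotv_le_enorm _ _) _; rewrite ler_pM//; exact: W2.
    have T3 : enorm (x v - x u) ^+ 2 <= (L * `|v - u|) ^+ 2.
      by rewrite ler_pXn2r ?nnegrE ?mulr_ge0.
    move=> d0; have T4 : (k + L ^+ 2) * `|v - u| ^+ 2 <= (k + L ^+ 2) * (T * `|v - u|).
      rewrite ler_wpM2l//; first by rewrite addr_ge0 ?sqr_ge0 ?(ltW k0).
      by rewrite expr2 ler_wpM2r.
    rewrite exprMn in T3; rewrite /B; lra.
  apply: (@ac_on_lipschitz _ _ _ B) => u v au uv vb.
  have uab : a <= u <= b1 by rewrite au (le_trans uv (le_trans vb bb)).
  have vab : a <= v <= b1 by rewrite (le_trans au uv) (le_trans vb bb).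
  have := key u v uab vab; have := key v u vab uab.
  rewrite distrC (ger0_norm (_ : 0 <= v - u)) ?subr_ge0// ler_norml; lra.
have dini m t : (forall s, a <= s <= b1 -> V s <= m) -> a <= t <= b1 ->
    V t <= (m + k^-1) / 2.
  move=> Vm tab; have [at_ tb] := andP tab.
  have m_0 : 0 <= m by rewrite (le_trans (V0 t))// Vm.
  have ki0 : 0 < k^-1 by rewrite invr_gt0.
  have : V t - V a <= 2 * (c * (m + k^-1)) * (t - a).
    have EN0 : (@lebesgue_measure R).-negligible (E `|` [set 0]).
      apply: negligibleU => //.
      exact: negligible_set1.
    apply: (@ac_dini_le _ V a t _ (E `|` [set 0])) => //; first exact: Vac.
    move=> s /andP[as_ st] Es d d0.
    have sab : a <= s <= b1 by rewrite as_ (le_trans (ltW st)).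
    have s0 : 0 < s.
      rewrite lt_def (le_trans a0 as_) andbT; apply/eqP => sz.
      by apply: Es; right.
    have [||zeta [g [dx Nz Gg xE zA]]] := good s _ _.
    - by rewrite s0 (lt_le_trans st)// (le_trans tb).
    - by move=> Es'; apply: Es; left.
    set q := x s - (W s).2.
    have q1 : 0 < enorm q + 1 by rewrite ltr_wpDl.
    have d'0 : 0 < d / (4 * (enorm q + 1)) by rewrite divr_gt0// mulr_gt0.
    have [eta eta0 hx] := derive1_incr dx d'0.
    have kL0 : 0 < k + L ^+ 2 by rewrite ltr_wpDr// sqr_ge0.
    (* The remainder of the derivative, counted twice, and the second-order terms each take half of
       [d]. *)
    exists (Num.min eta (d / (2 * (k + L ^+ 2)))).
      by rewrite lt_min eta0 divr_gt0// mulr_gt0.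
    move=> v /andP[sv]; rewrite -lerBlDl le_min => /andP[veta vd] vt.
    apply: (@le_trans _ _ (phi v (W s) - phi s (W s))); first by rewrite lerD2r.
    have sT : 0 <= s <= T by apply: abT.
    have vT : 0 <= v <= T.
      by rewrite (le_trans (ltW s0) sv) (le_trans vt (le_trans tb b1T)).
    rewrite phiD//.
    have := hx (v - s); rewrite (ger0_norm (_ : 0 <= v - s)) ?subr_ge0//.
    rewrite (_ : s + (v - s) = v); last by rewrite addrC subrK.
    move=> /(_ veta); set D := x v - x s - _ => hD.
    have xvs : x v - x s = D + (v - s) *: derive1 x s by rewrite subrK.
    have T1 : dotv (x v - x s) q = dotv D q + (v - s) * dotv (derive1 x s) q.
      by rewrite {1}xvs dotvDl dotvZl.
    have T2 : dotv D q <= d / 4 * (v - s).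
      apply: le_trans (dotv_le_enorm _ _) _.
      apply: (@le_trans _ _ (d / (4 * (enorm q + 1)) * (v - s) * (enorm q + 1))).
        by rewrite ler_pM// lerDl.
      rewrite mulrAC invfM mulrA divfK//; last by rewrite gt_eqF.
    have T3 : k * (v - s) ^+ 2 + enorm (x v - x s) ^+ 2 <= (v - s) * (d / 2).
      apply: (@le_trans _ _ ((k + L ^+ 2) * (v - s) ^+ 2)).
        rewrite mulrDl lerD2l -exprMn ler_pXn2r ?nnegrE ?mulr_ge0 ?subr_ge0//.
        by case/andP: sT => ? _; case/andP: vT => _ ?; apply: xL.
      rewrite expr2 mulrCA ler_wpM2l ?subr_ge0// mulrC -ler_pdivlMr//.
      by rewrite -mulrA -invfM.
    have T4 : k * (tau s - (W s).1) + dotv (derive1 x s) q <= c * (m + k^-1).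
      have [SW Wmin] := WP s.
      have tsE : tau s = t0 + s by rewrite tauE.
      have t0s : 0 <= tau s by rewrite tsE addr_ge0// ltW.
      rewrite xE; rewrite -tsE in Nz Gg.
      apply: le_trans (drift k (tau s) (x s) (W s).1 (W s).2 zeta g k1 t0s SW Wmin Nz zA Gg) _.
      rewrite ler_wpM2l// lerD2r; exact: Vm.
    have T5 : (v - s) * (k * (tau s - (W s).1) + dotv (derive1 x s) q) <= (v - s) * (c * (m + k^-1)).
      by rewrite ler_wpM2l// subr_ge0.
    rewrite T1; lra.
  rewrite Va subr0 => /le_trans; apply.
  have : (m + k^-1) * (4 * c * (t - a)) <= (m + k^-1) * 1.
    rewrite ler_wpM2l//; first by rewrite addr_ge0// ltW.
    apply: le_trans hc; rewrite ler_wpM2l ?mulr_ge0//; lra.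
  lra.
have b1ab : a <= b1 <= b1 by rewrite ab1 lexx.
(* Apply [dini] with [m] the supremum of [V] on [[a, b1]]. *)
have Vk : V b1 <= k^-1.
  pose I := [set V s | s in [set s | a <= s <= b1]].
  have supI : has_sup I.
    split; first by exists (V b1), b1.
    by exists m0 => _ [s /Vm0 sm <-].
  have Vm s : a <= s <= b1 -> V s <= sup I.
    by move=> sab; apply: (sup_upper_bound supI); exists s.
  have : sup I <= (sup I + k^-1) / 2.
    apply: ge_sup; first by exists (V b1), b1.
    by move=> _ [s sab <-]; exact: dini.
  have := Vm _ b1ab; lra.
have [SW _] := WP b1; exists (tx (W b1).1 (W b1).2) => //.
rewrite -(@ltr_pXn2r _ 2)// ?nnegrE ?(ltW e0)//.
rewrite tx_sub sqr_enorm_tx; apply: le_lt_trans ke; apply: le_trans Vk.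
by rewrite /V /phi lerD2r ler_peMl// sqr_ge0.
Qed.

Lemma invariance_sufficient : strongly_invariant C G S.
Proof.
move=> t0 x0 S0 T T0 tau x sol.
have [h h0 step] := invariance_step T0 S0 sol.
have Sz : S (tx (tau 0) (x 0)) by have [_ _ _ -> ->] := sol.
suff H N t : 0 <= t <= T -> t <= N%:R * h -> S (tx (tau t) (x t)).
  move=> t; rewrite in_itv/= => tT; apply: (H (Num.truncn (t / h)).+1) => //.
  by rewrite -ler_pdivrMr// ltW// truncnS_gt.
elim: N t => [|N IH] t /andP[t_0 tT].
  rewrite mul0r => t_0'; suff -> : t = 0 by [].
  by apply/eqP; rewrite eq_le t_0 t_0'.
rewrite -natr1 mulrDl mul1r => tN; have [|Nt] := leP t (N%:R * h).
  by apply: IH; rewrite t_0.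
have Nh0 : 0 <= N%:R * h by rewrite mulr_ge0// ltW.
apply: (step (N%:R * h)) => //; last by rewrite tN ltW.
by apply: IH => //; rewrite Nh0 (le_trans (ltW Nt)).
Qed.

End sufficiency.

(** * The catching-up scheme *)

(* Limits along an ultrafilter replace the extraction of a uniformly
   convergent subsequence by Arzela-Ascoli. *)
Lemma pointwise_ultralimit (R : realType) (n : nat) (T : Type)
    (f : nat -> T -> 'rV[R]_n) (B : T -> R) :
  (forall m t, enorm (f m t) <= B t) ->
  exists (U : set_system nat) (F : T -> 'rV[R]_n),
    [/\ ProperFilter U, \oo `<=` U & forall t, f m t @[m --> U] --> F t].
Proof.
move=> fB; have [U [UU ooU]] := ultraFilterLemma eventually_filter.
suff /choice[F hF] t : exists v : 'rV[R]_n, f m t @[m --> U] --> v.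
  by exists U, F; split => //; exact: ultra_proper.
have cB : compact [set v : 'rV[R]_n | enorm v <= B t].
  apply: (@compact_enorm _ _ _ (B t)) => //; apply/closed_enormP => v h /=.
  apply/ler_addgt0Pr => e /h[u uB vu].
  rewrite -(subrK u v) addrC (le_trans (ler_enormD _ _))//.
  by rewrite lerD// ltW.
have UB : (f m t @[m --> U]) [set v : 'rV[R]_n | enorm v <= B t].
  have UT : U setT by exact: filterT.
  by apply: (@filterS _ U _ _ _ _ UT) => m _; exact: (fB m t).
have [v [_ vcl]] := cB _ _ UB; exists v => A vA.
have [//|UnA] := in_ultra_setVsetC ((fun m => f m t) @^-1` A) UU.
have [w [wA Aw]] := vcl (~` A) A UnA vA.
by [].
Qed.

Lemma natrS_mul (R : pzRingType) (d : nat) (h : R) : d.+1%:R * h = d%:R * h + h.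
Proof. by rewrite -natr1 mulrDl mul1r. Qed.

Section scheme.
Context {R : realType} {n : nat}.
Context (C : R -> set 'rV[R]_n) (G : R -> 'rV[R]_n -> set 'rV[R]_n) (LC M LG : R).
Hypotheses (hC : H_C C LC) (hG : H_G G M LG).

Local Notation A := (LC + M).
Local Notation V := (LC + M + M).
Local Notation Lg := (LG * (1 + V)).

(** The residual [X i + h *: g i - X i.+1] is a normal at the projected point. Only estimates that
    survive the limit are recorded: [prox_normal] hides a constant [sigma] that could vary with the
    step, whereas [h * (A / (2 * r))] is explicit. *)
Definition catching_up (r t0 h : R) (X g : nat -> 'rV[R]_n) : Prop :=
  [/\ forall i, C (t0 + i%:R * h) (X i),
      forall i, G (t0 + i%:R * h) (X i) (g i),
      forall i, enorm (X i + h *: g i - X i.+1) <= h * A,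
      forall i y, C (t0 + i.+1%:R * h) y ->
        dotv (X i + h *: g i - X i.+1) (y - X i.+1) <=
          h * (A / (2 * r) * enorm (y - X i.+1) ^+ 2) &
      forall i, enorm (g i.+1 - g i) <= h * Lg].

(** The projection is no farther than the point of the next set close to [X], hence a residual at
    most [h * LC + h * M]. The displacement is then at most [h * V], and the Lipschitz property of
    [G] yields [h * Lg]. *)
Lemma catching_up_step (r t0 h : R) (i : nat) (X g : 'rV[R]_n) :
  0 < r -> (forall t, 0 <= t -> prox_regular r (C t)) ->
  0 <= t0 -> 0 < h -> C (t0 + i%:R * h) X -> G (t0 + i%:R * h) X g ->
  exists w : 'rV[R]_n * 'rV[R]_n, [/\ C (t0 + i.+1%:R * h) w.1,
    G (t0 + i.+1%:R * h) w.1 w.2, enorm (X + h *: g - w.1) <= h * A,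
    (forall y, C (t0 + i.+1%:R * h) y ->
        dotv (X + h *: g - w.1) (y - w.1) <=
          h * (A / (2 * r) * enorm (y - w.1) ^+ 2)) &
    enorm (w.2 - g) <= h * Lg].
Proof.
move=> r0 Cr t00 h0 CX Gg.
have [C0 _ _] := hC; have [_ GM _] := hG.
have LC0 := H_C_ge0 hC; have [M0 LG0] := H_G_ge0 hG.
have ti0 j : 0 <= t0 + j%:R * h by rewrite addr_ge0// mulr_ge0// ltW.
have dt : t0 + i%:R * h - (t0 + i.+1%:R * h) = - h.
  by rewrite natrS_mul; lra.
have [X' CX' X'min] := nearest_point (X + h *: g) (Cr _ (ti0 i.+1)).1 (C0 _ (ti0 i.+1)).1.
have [Y CY XY] := H_C_near hC (ti0 i) (ti0 i.+1) CX.
rewrite dt normrN (gtr0_norm h0) in XY.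
have gM : enorm g <= M by apply: GM Gg.
have dX' : enorm (X + h *: g - X') <= h * A.
  apply: le_trans (X'min _ CY) _; rewrite addrAC (le_trans (ler_enormD _ _))//.
  rewrite enormZ (gtr0_norm h0) mulrDr lerD//; first by rewrite mulrC.
  by rewrite ler_wpM2l// ltW.
have XX' : enorm (X - X') <= h * V.
  have -> : X - X' = (X + h *: g - X') - h *: g by rewrite addrAC addrK.
  rewrite (le_trans (ler_enormB _ _))// enormZ (gtr0_norm h0) mulrDr lerD//.
  by rewrite ler_wpM2l// ltW.
have [g' Gg' gg'] := H_G_near hG X' (ti0 i) (ti0 i.+1) Gg.
exists (X', g'); split => //=.
- move=> y Cy; have N := proj_prox_normal CX' X'min.
  apply: le_trans (prox_regular_le r0 (Cr _ (ti0 i.+1)) N dX' Cy) _.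
  by rewrite !mulrA.
- rewrite edistC; apply: le_trans gg' _; rewrite mulrCA ler_wpM2l//.
  rewrite dt (le_trans (enorm_tx_le _ _))// normrN (gtr0_norm h0) mulrDr mulr1.
  by rewrite lerD2l.
Qed.

Lemma catching_up_exists (r t0 h : R) (x0 g0 : 'rV[R]_n) :
  0 < r -> (forall t, 0 <= t -> prox_regular r (C t)) ->
  0 <= t0 -> 0 < h -> C t0 x0 -> G t0 x0 g0 ->
  exists X g, [/\ catching_up r t0 h X g, X 0%N = x0 & g 0%N = g0].
Proof.
move=> r0 Cr t00 h0 Cx0 Gg0.
(* The admissibility of [p] is a premise inside the existential, so that choice gives a total step
   function; [(x0, g0)] is a default value at inadmissible [p]. *)
have ex (p : nat * ('rV[R]_n * 'rV[R]_n)) : exists w : 'rV[R]_n * 'rV[R]_n,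
    C (t0 + p.1%:R * h) p.2.1 -> G (t0 + p.1%:R * h) p.2.1 p.2.2 ->
    [/\ C (t0 + p.1.+1%:R * h) w.1,
    G (t0 + p.1.+1%:R * h) w.1 w.2, enorm (p.2.1 + h *: p.2.2 - w.1) <= h * A,
    (forall y, C (t0 + p.1.+1%:R * h) y ->
        dotv (p.2.1 + h *: p.2.2 - w.1) (y - w.1) <=
          h * (A / (2 * r) * enorm (y - w.1) ^+ 2)) &
    enorm (w.2 - p.2.2) <= h * Lg].
  have [[H1 H2]|H] := pselect (C (t0 + p.1%:R * h) p.2.1 /\ G (t0 + p.1%:R * h) p.2.1 p.2.2).
    by have [w] := catching_up_step r0 Cr t00 h0 H1 H2; exists w.
  by exists (x0, g0) => H1 H2; exfalso; apply: H.
have [F FP] := choice ex.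
pose Z := fix Z i : 'rV[R]_n * 'rV[R]_n := if i is j.+1 then F (j, Z j) else (x0, g0).
have ZP i : C (t0 + i%:R * h) (Z i).1 /\ G (t0 + i%:R * h) (Z i).1 (Z i).2.
  elim: i => [|i [H1 H2]]; first by rewrite mul0r addr0.
  by have [] := FP (i, Z i) H1 H2.
exists (fun i => (Z i).1), (fun i => (Z i).2); split => //.
by split => i; have [H1 H2] := ZP i; have [] := FP (i, Z i) H1 H2.
Qed.

Section increments.
Context (r t0 h : R) (X g : nat -> 'rV[R]_n).
Hypotheses (r0 : 0 < r) (t00 : 0 <= t0) (h0 : 0 < h) (cu : catching_up r t0 h X g).

Lemma catching_up_lipschitz i d :
  enorm (X (i + d)%N - X i) <= V * (d%:R * h) /\
  enorm (g (i + d)%N - g i) <= Lg * (d%:R * h).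
Proof.
have [_ GM _] := hG; have [XC XG XA _ gL] := cu.
have ti0 j : 0 <= t0 + j%:R * h by rewrite addr_ge0// mulr_ge0// ltW.
elim: d => [|d [IHX IHg]].
  by rewrite addn0 !subrr enorm0 mul0r !mulr0.
rewrite addnS natrS_mul; split.
  apply: le_trans (ler_edistD (X (i + d)%N) _ _) _; rewrite mulrDr addrC.
  apply: lerD => //.
  have -> : X (i + d).+1 - X (i + d)%N =
    h *: g (i + d)%N - (X (i + d)%N + h *: g (i + d)%N - X (i + d).+1).
    by apply/rowP => j; rewrite !mxE; ring.
  apply: le_trans (ler_enormB _ _) _; rewrite enormZ (gtr0_norm h0) addrC mulrDl.
  apply: lerD; first by rewrite mulrC XA.
  by rewrite mulrC ler_wpM2r ?(ltW h0)//; apply: GM (XG _).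
apply: le_trans (ler_edistD (g (i + d)%N) _ _) _; rewrite mulrDr addrC.
by apply: lerD => //; rewrite mulrC.
Qed.

(** Up to the variation of [g], the vector is a sum of [d] residuals of size at most [h * A]; that
    variation is of second order in [d%:R * h]. In the limit this bounds the normal by [LC + M]. *)
Lemma catching_up_drift i d :
  enorm (X i - X (i + d)%N + (d%:R * h) *: g i) <= A * (d%:R * h) + Lg * (d%:R * h) ^+ 2.
Proof.
have [_ _ XA _ _] := cu; have [M0 LG0] := H_G_ge0 hG; have LC0 := H_C_ge0 hC.
have Lg0 : 0 <= Lg by rewrite mulr_ge0// !addr_ge0.
elim: d => [|d IH].
  by rewrite addn0 subrr mul0r scale0r addr0 enorm0 expr0n/= !mulr0 addr0.
rewrite addnS natrS_mul.
have -> : X i - X (i + d).+1 + (d%:R * h + h) *: g i =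
  (X i - X (i + d)%N + (d%:R * h) *: g i) + (X (i + d)%N + h *: g (i + d)%N - X (i + d).+1)
   - h *: (g (i + d)%N - g i).
  rewrite scalerBr scalerDl; apply/rowP => j; rewrite !mxE; ring.
apply: le_trans (ler_enormB _ _) _; rewrite enormZ (gtr0_norm h0).
have [_ gd] := catching_up_lipschitz i d.
have := ler_enormD (X i - X (i + d)%N + (d%:R * h) *: g i)
  (X (i + d)%N + h *: g (i + d)%N - X (i + d).+1).
have := XA (i + d)%N; have : h * enorm (g (i + d)%N - g i) <= h * (Lg * (d%:R * h)).
  by rewrite ler_wpM2l// ltW.
have d0 : 0 <= d%:R * h by rewrite mulr_ge0// ltW.
move: (d%:R * h) d0 IH => D D0 IH.
have h0' := ltW h0.
have : 0 <= Lg * (D * h) by apply: mulr_ge0 => //; exact: mulr_ge0.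
have : 0 <= Lg * (h * h) by apply: mulr_ge0 => //; exact: mulr_ge0.
clear Lg0; lra.
Qed.

(** Integrated form of the normal inequality. Each residual is normal to a later set at a later
    point, so [y] and the base point are moved there at cost [(LC + V) * D]. Since [D] bounds the
    whole elapsed time, every step has the same bound and induction adds them. *)
Lemma catching_up_normal i d D y :
  C (t0 + i%:R * h) y -> d%:R * h <= D ->
  dotv (X i - X (i + d)%N + (d%:R * h) *: g i) (y - X i) <=
  d%:R * h * (A / (2 * r) * (enorm (y - X i) + (LC + V) * D) ^+ 2 + A * ((LC + V) * D)
    + Lg * D * enorm (y - X i)).
Proof.
have [_ _ XA XN _] := cu; have [M0 LG0] := H_G_ge0 hG; have LC0 := H_C_ge0 hC.
have ti0 j : 0 <= t0 + j%:R * h by rewrite addr_ge0// mulr_ge0// ltW.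
have Lg0 : 0 <= Lg by rewrite mulr_ge0// !addr_ge0.
move=> Cy; elim: d => [|d IH].
  by rewrite addn0 subrr mul0r scale0r addr0 dotv0l mul0r.
rewrite addnS natrS_mul => dD.
have dD' : d%:R * h <= D by rewrite (le_trans _ dD)// lerDl ltW.
have d0 : 0 <= d%:R * h by rewrite mulr_ge0// ltW.
have D0 : 0 <= D by rewrite (le_trans d0).
have {IH} := IH dD'.
set Q := A / (2 * r) * _ + _ + _ => IH.
have -> : X i - X (i + d).+1 + (d%:R * h + h) *: g i =
  (X i - X (i + d)%N + (d%:R * h) *: g i) + (X (i + d)%N + h *: g (i + d)%N - X (i + d).+1)
   - h *: (g (i + d)%N - g i).
  rewrite scalerBr scalerDl; apply/rowP => j; rewrite !mxE; ring.
rewrite dotvBl dotvDl dotvZl mulrDl -addrA lerD//.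
set P := X (i + d)%N + h *: g (i + d)%N - X (i + d).+1.
set X' := X (i + d).+1.
have PA : enorm P <= h * A by exact: XA.
have [gy Cgy ygy] := H_C_near hC (ti0 i) (ti0 (i + d).+1) Cy.
have {}ygy : enorm (y - gy) <= LC * D.
  apply: le_trans ygy _; rewrite ler_wpM2l//.
  have -> : (i + d).+1%:R * h = i%:R * h + (d%:R * h + h).
    by rewrite natrS_mul natrD mulrDl addrA.
  rewrite (_ : t0 + _ - _ = - (d%:R * h + h)); last by ring.
  by rewrite normrN ger0_norm// addr_ge0// ltW.
have XX' : enorm (X' - X i) <= V * D.
  have [+ _] := catching_up_lipschitz i d.+1; rewrite addnS => /le_trans; apply.
  by rewrite ler_wpM2l ?addr_ge0// natrS_mul.
have H1 := XN (i + d)%N gy Cgy; rewrite -/P -/X' in H1.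
have H2 : enorm (gy - X') <= enorm (y - X i) + (LC + V) * D.
  have := ler_edistD y gy X'; have := ler_edistD (X i) y X'.
  rewrite (edistC gy y) (edistC (X i) X'); lra.
have H3 : A / (2 * r) * enorm (gy - X') ^+ 2 <=
    A / (2 * r) * (enorm (y - X i) + (LC + V) * D) ^+ 2.
  rewrite ler_wpM2l//; first by rewrite divr_ge0 ?addr_ge0// mulr_ge0// ltW.
  by rewrite ler_pXn2r ?nnegrE ?addr_ge0// mulr_ge0// !addr_ge0.
have H4 : dotv P (y - gy) <= h * A * (LC * D).
  by apply: le_trans (dotv_le_enorm _ _) _; rewrite ler_pM.
have H5 : dotv P (X' - X i) <= h * A * (V * D).
  by apply: le_trans (dotv_le_enorm _ _) _; rewrite ler_pM.
have H6 : - dotv (g (i + d)%N - g i) (y - X i) <= Lg * D * enorm (y - X i).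
  rewrite -dotvNl; apply: le_trans (dotv_le_enorm _ _) _; rewrite enormN ler_wpM2r//.
  have [_ /le_trans] := catching_up_lipschitz i d; apply.
  by rewrite ler_wpM2l.
have -> : dotv P (y - X i) = dotv P (gy - X') + dotv P (y - gy) + dotv P (X' - X i).
  by rewrite -!dotvDr; congr dotv; apply/rowP => j; rewrite !mxE; ring.
have H7 : h * - dotv (g (i + d)%N - g i) (y - X i) <= h * (Lg * D * enorm (y - X i)).
  by rewrite ler_wpM2l// ltW.
have H8 := ler_wpM2l (ltW h0) H3.
rewrite /Q; set q := A / (2 * r) * (_ + _) ^+ 2 in H8 *.
set q' := A / (2 * r) * _ in H1 H8; set z := Lg * D * _ in H7 *.
clearbody q q' z; lra.
Qed.

End increments.
End scheme.

(** * Uniform time grids *)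

Section grid.
Context {R : realType}.

Definition mesh (m : nat) : R := m.+1%:R^-1.
Definition grid_index (m : nat) (t : R) : nat := Num.truncn (t / mesh m).
Definition grid (m : nat) (t : R) : R := (grid_index m t)%:R * mesh m.

Lemma mesh_gt0 m : 0 < mesh m.
Proof. by rewrite invr_gt0. Qed.

Lemma grid_le m t : 0 <= t -> grid m t <= t.
Proof.
move=> t0; rewrite -ler_pdivlMr ?mesh_gt0// truncn_le//.
by rewrite divr_ge0// ltW// mesh_gt0.
Qed.

Lemma grid_ge0 m t : 0 <= grid m t.
Proof. by rewrite mulr_ge0// ltW// mesh_gt0. Qed.

Lemma grid_gt m t : t - mesh m < grid m t.
Proof.
rewrite ltrBlDr -natrS_mul -ltr_pdivrMr ?mesh_gt0//; exact: truncnS_gt.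
Qed.

Lemma grid_index_le m s t : s <= t -> (grid_index m s <= grid_index m t)%N.
Proof. by move=> st; apply: le_truncn; rewrite ler_pM2r ?invr_gt0 ?mesh_gt0. Qed.

Lemma cvg_mesh : mesh m @[m --> \oo] --> (0 : R).
Proof. exact: cvg_harmonic. Qed.

Lemma cvg_grid t : 0 <= t -> grid m t @[m --> \oo] --> t.
Proof.
move=> t0; apply: (@squeeze_cvgr _ _ _ _ (fun m => t - mesh m) (fun=> t)).
- by apply: nearW => m; rewrite (ltW (grid_gt m t)) grid_le.
- by rewrite -[X in _ --> X]subr0; apply: cvgB; [exact: cvg_cst|exact: cvg_mesh].
- exact: cvg_cst.
Qed.

End grid.

Lemma closed_cvg_near (R : realType) (n : nat) (A : set 'rV[R]_n)
    (U : set_system nat) (UP : ProperFilter U) (f : nat -> 'rV[R]_n) v (d : nat -> R) :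
  closed A -> f m @[m --> U] --> v -> d m @[m --> U] --> 0 ->
  (forall m, exists2 z, A z & enorm (f m - z) <= d m) -> A v.
Proof.
move=> /closed_enormP cA fv d0 fA; apply: cA => e e0.
have e2 : 0 < e / 2 by rewrite divr_gt0.
have H2 : \forall m \near U, enorm (v - f m) < e / 2 by exact/(cvg_enormP _ _ _).1.
have H1 : \forall m \near U, d m < e / 2 by exact: cvgr_lt d0 _ e2.
have [m [dm fm]] := filter_ex (filterI H1 H2).
have [z Az fz] := fA m; exists z => //.
by apply: le_lt_trans (ler_edistD (f m) _ _) _; rewrite [ltRHS]splitr ltr_leD// (le_trans fz)// ltW.
Qed.

(** * Limit of the catching-up scheme *)

Section existence.
Context {R : realType} {n : nat}.
Context (C : R -> set 'rV[R]_n) (G : R -> 'rV[R]_n -> set 'rV[R]_n) (LC M LG : R).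
Hypotheses (hC : H_C C LC) (hG : H_G G M LG).

Local Notation A := (LC + M).
Local Notation V := (LC + M + M).
Local Notation Lg := (LG * (1 + V)).

(** All conclusions are closed conditions at one or two times, so pointwise convergence of the
    piecewise constant interpolants suffices. The differential inclusion is recovered from the
    integrated inequalities in [solution_exists]. *)
Lemma catching_up_limit (r t0 : R) (x0 g0 : 'rV[R]_n) :
  0 < r -> (forall t, 0 <= t -> prox_regular r (C t)) ->
  0 <= t0 -> C t0 x0 -> G t0 x0 g0 ->
  exists x g : R -> 'rV[R]_n, [/\ x 0 = x0 /\ g 0 = g0,
    forall t, 0 <= t -> C (t0 + t) (x t) /\ G (t0 + t) (x t) (g t),
    forall s t, 0 <= s -> s <= t -> enorm (x t - x s) <= V * (t - s),
    forall s t, 0 <= s -> s <= t ->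
      enorm (x s - x t + (t - s) *: g s) <= A * (t - s) + Lg * (t - s) ^+ 2 &
    forall s t y, 0 <= s -> s <= t -> C (t0 + s) y ->
      dotv (x s - x t + (t - s) *: g s) (y - x s) <=
      (t - s) * (A / (2 * r) * (enorm (y - x s) + (LC + V) * (t - s)) ^+ 2
        + A * ((LC + V) * (t - s)) + Lg * (t - s) * enorm (y - x s))].
Proof.
move=> r0 Cr t00 Cx0 Gg0.
have [_ GM _] := hG; have LC0 := H_C_ge0 hC; have [M0 LG0] := H_G_ge0 hG.
have V0 : 0 <= V by rewrite !addr_ge0.
have ex m : exists Xg : (nat -> 'rV[R]_n) * (nat -> 'rV[R]_n),
    [/\ catching_up C G LC M LG r t0 (mesh m) Xg.1 Xg.2, Xg.1 0%N = x0 & Xg.2 0%N = g0].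
  have [X [g h]] := catching_up_exists hC hG r0 Cr t00 (mesh_gt0 m) Cx0 Gg0.
  by exists (X, g).
have [Xg XgP] := choice ex.
pose xm m (t : R) := (Xg m).1 (grid_index m t).
pose gm m (t : R) := (Xg m).2 (grid_index m t).
have gridD m (s t : R) : s <= t -> exists2 d, (grid_index m t = grid_index m s + d)%N &
    d%:R * mesh m = grid m t - grid m s.
  move=> /(grid_index_le m) st; exists (grid_index m t - grid_index m s)%N.
    by rewrite subnKC.
  by rewrite natrB// mulrBl.
have g00 m : grid_index m (0 : R) = 0%N by rewrite /grid_index mul0r truncn0.
have xm_lip m s t : s <= t -> enorm (xm m t - xm m s) <= V * (grid m t - grid m s).
  move=> st; have [d E <-] := gridD m s t st; have [cu _ _] := XgP m.
  by rewrite /xm E; have [] := catching_up_lipschitz hG t00 (mesh_gt0 m) cu (grid_index m s) d.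
(* The boolean lets positions and perturbations converge along the same ultrafilter; negative times
   are sent to 0. *)
pose f m (p : R * bool) := if p.2 then xm m (Num.max 0 p.1) else gm m (Num.max 0 p.1).
pose B (p : R * bool) := if p.2 then enorm x0 + V * `|p.1| else M.
have maxabs (t : R) : Num.max 0 t <= `|t| by rewrite ge_max normr_ge0 ler_norm.
have max0 (t : R) : 0 <= Num.max 0 t by rewrite le_max lexx.
have fB m p : enorm (f m p) <= B p.
  case: p => t [] /=; rewrite /f/=; have [cu X0 G0] := XgP m.
    have := xm_lip m 0 (Num.max 0 t) (max0 t).
    rewrite /grid g00 mul0r subr0 -/(grid m (Num.max 0 t)).
    have -> : xm m 0 = x0 by rewrite /xm g00.
    move=> h; rewrite -(subrK x0 (xm m (Num.max 0 t))) addrC.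
    apply: le_trans (ler_enormD _ _) _; rewrite lerD2l; apply: le_trans h _.
    by rewrite ler_wpM2l// (le_trans (grid_le _ _)).
  have [_ XG _ _ _] := cu; apply: GM (XG _).
  by rewrite addr_ge0// grid_ge0.
have [U [F [UP ooU FP]]] := pointwise_ultralimit fB.
pose x t := F (t, true); pose g t := F (t, false).
have xP t : 0 <= t -> xm m t @[m --> U] --> x t.
  by move=> t_0; have := FP (t, true); rewrite /f/= max_r.
have gP t : 0 <= t -> gm m t @[m --> U] --> g t.
  by move=> t_0; have := FP (t, false); rewrite /f/= max_r.
have gridP t : 0 <= t -> grid m t @[m --> U] --> t.
  by move=> /cvg_grid h; apply: cvg_trans h => P /ooU.
have distP t : 0 <= t -> `|t0 + grid m t - (t0 + t)| @[m --> U] --> (0 : R).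
  move=> t_0; have -> : (fun m => `|t0 + grid m t - (t0 + t)|) = (fun m => `|grid m t - t|).
    by apply/funext => m; congr `|_|; lra.
  by rewrite -(normr0 R) -(subrr t); apply: cvg_norm; apply: cvgB; [exact: gridP|exact: cvg_cst].
have Cx m t : C (t0 + grid m t) (xm m t).
  by have [[XC _ _ _ _] _ _] := XgP m; exact: XC.
have Gx m t : G (t0 + grid m t) (xm m t) (gm m t).
  by have [[_ XG _ _ _] _ _] := XgP m; exact: XG.
have tg0 m t : 0 <= t0 + grid m t by rewrite addr_ge0// grid_ge0.
have cvg0 (v : R) (u : nat -> R) : u m @[m --> U] --> 0 -> v * u m @[m --> U] --> 0.
  by move=> u0; rewrite -(mulr0 v); apply: cvgM => //; exact: cvg_cst.
exists x, g; split.
- split.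
    have := xP 0 (lexx 0); have -> : xm^~ 0 = fun=> x0.
      by apply/funext => m; rewrite /xm g00; have [] := XgP m.
    move=> h; apply: (cvg_unique _ h); [exact: norm_hausdorff|exact: cvg_cst].
  have := gP 0 (lexx 0); have -> : gm^~ 0 = fun=> g0.
    by apply/funext => m; rewrite /gm g00; have [] := XgP m.
  move=> h; apply: (cvg_unique _ h); [exact: norm_hausdorff|exact: cvg_cst].
- move=> t t_0; have tt0 : 0 <= t0 + t by rewrite addr_ge0.
  split.
    apply: (@closed_cvg_near _ _ _ U UP _ _ (fun m => LC * `|t0 + grid m t - (t0 + t)|) (Cr _ tt0).1 (xP t t_0)).
      by apply: cvg0; exact: distP.
    by move=> m; have [z] := H_C_near hC (tg0 m t) tt0 (Cx m t); exists z.
  have [Gc _ _] := hG; have [_ cG _] := Gc (t0 + t) (x t) tt0.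
  apply: (@closed_cvg_near _ _ _ U UP _ _
    (fun m => LG * (`|t0 + grid m t - (t0 + t)| + enorm (xm m t - x t))) cG (gP t t_0)).
    apply: cvg0; rewrite -(addr0 0); apply: cvgD; first exact: distP.
    rewrite -(@enorm0 R n) -(subrr (x t)).
    apply: (@cvg_enorm _ _ _ U _ (fun m => xm m t - x t)).
    by apply: cvgB; [exact: xP|exact: cvg_cst].
  move=> m; have [z Gz zd] := H_G_near hG (x t) (tg0 m t) tt0 (Gx m t).
  by exists z => //; apply: le_trans zd _; rewrite ler_wpM2l// enorm_tx_le.
- move=> s t s0 st; have t_0 := le_trans s0 st.
  apply: (@ler_cvg_to _ U UP R (fun m => enorm (xm m t - xm m s)) (fun m => V * (grid m t - grid m s))).
  + apply: (@cvg_enorm _ _ _ U _ (fun m => xm m t - xm m s)).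
    by apply: cvgB; exact: xP.
  + by apply: cvgM; [exact: cvg_cst|apply: cvgB; exact: gridP].
  + by apply: nearW => m; exact: xm_lip.
- move=> s t s0 st; have t_0 := le_trans s0 st.
  apply: (@ler_cvg_to _ U UP R (fun m => enorm (xm m s - xm m t + (grid m t - grid m s) *: gm m s))
    (fun m => A * (grid m t - grid m s) + Lg * (grid m t - grid m s) ^+ 2)).
  + apply: (@cvg_enorm _ _ _ U _ (fun m => xm m s - xm m t + (grid m t - grid m s) *: gm m s)).
    apply: cvgD; first by apply: cvgB; exact: xP.
    by apply: cvgZ; [apply: cvgB; exact: gridP|exact: gP].
  + have dP : grid m t - grid m s @[m --> U] --> t - s by apply: cvgB; exact: gridP.
    apply: cvgD; first by apply: cvgM => //; exact: cvg_cst.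
    by apply: cvgM; [exact: cvg_cst|apply: cvgM].
  + apply: nearW => m; have [d E <-] := gridD m s t st; have [cu _ _] := XgP m.
    by rewrite /xm /gm E; exact: (catching_up_drift hC hG t00 (mesh_gt0 m) cu).
- move=> s t y s0 st Cy; have t_0 := le_trans s0 st; have ts0 : 0 <= t0 + s by rewrite addr_ge0.
  (* The discrete inequality tests points of [C] at grid times, so [y] is approximated by such
     points. *)
  have exy m : exists z, C (t0 + grid m s) z /\ enorm (y - z) <= LC * `|t0 + grid m s - (t0 + s)|.
    have [z Cz yz] := H_C_near hC ts0 (tg0 m s) Cy.
    by exists z; rewrite distrC.
  have [ym ymP] := choice exy.
  have yP : ym m @[m --> U] --> y.
    apply/cvg_enormP => e e0.
    have : \forall m \near U, LC * `|t0 + grid m s - (t0 + s)| < e.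
      exact: cvgr_lt (cvg0 LC _ (distP s s0)) _ e0.
    by apply: filterS => m; apply: le_lt_trans; have [] := ymP m.
  have yxP : ym m - xm m s @[m --> U] --> y - x s by apply: cvgB => //; exact: xP.
  have eyxP : enorm (ym m - xm m s) @[m --> U] --> enorm (y - x s).
    exact: (@cvg_enorm _ _ _ U _ (fun m => ym m - xm m s)).
  have dP : grid m t - grid m s @[m --> U] --> t - s by apply: cvgB; exact: gridP.
  have cD (k l : R) (u w : nat -> R) : u m @[m --> U] --> k -> w m @[m --> U] --> l ->
      u m + w m @[m --> U] --> k + l by move=> *; exact: cvgD.
  have cX (k l : R) (u w : nat -> R) : u m @[m --> U] --> k -> w m @[m --> U] --> l ->
      u m * w m @[m --> U] --> k * l by move=> *; exact: cvgM.
  have cM (k l : R) (u : nat -> R) : u m @[m --> U] --> l -> k * u m @[m --> U] --> k * l.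
    by move=> ul; apply: cvgM => //; exact: cvg_cst.
  apply: (@ler_cvg_to _ U UP R
    (fun m => dotv (xm m s - xm m t + (grid m t - grid m s) *: gm m s) (ym m - xm m s))
    (fun m => (grid m t - grid m s) * (A / (2 * r) *
       (enorm (ym m - xm m s) + (LC + V) * (grid m t - grid m s)) ^+ 2
        + A * ((LC + V) * (grid m t - grid m s))
        + Lg * (grid m t - grid m s) * enorm (ym m - xm m s)))).
  + apply: (@cvg_dotv _ _ _ U _ (fun m => xm m s - xm m t + (grid m t - grid m s) *: gm m s)) => //.
    apply: cvgD; first by apply: cvgB; exact: xP.
    by apply: cvgZ => //; exact: gP.
  + have c1 := cM Lg _ _ dP; have c2 := cM A _ _ (cM (LC + V) _ _ dP).
    have c3 := cD _ _ _ _ eyxP (cM (LC + V) _ _ dP).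
    have c4 := cM (A / (2 * r)) _ _ (cX _ _ _ _ c3 c3).
    exact: cX _ _ _ _ dP (cD _ _ _ _ (cD _ _ _ _ c4 c2) (cX _ _ _ _ c1 eyxP)).
  + apply: nearW => m; have [d E dE] := gridD m s t st; have [cu _ _] := XgP m.
    rewrite -dE /xm /gm E.
    have [Cym _] := ymP m.
    exact: (catching_up_normal hC hG r0 t00 (mesh_gt0 m) cu Cym (lexx _)).
Qed.

End existence.

(** * Necessity *)

Lemma lipschitz_rV_ae_derivable (R : realType) (n : nat) (x : R -> 'rV[R]_n) (L : R) :
  (forall s t, enorm (x s - x t) <= L * `|s - t|) ->
  {ae @lebesgue_measure R, forall t, derivable x t 1}.
Proof.
move=> xL.
have H : {ae @lebesgue_measure R, forall t, forall i : 'I_n, derivable (fun t => x t 0 i) t 1}.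
  apply: filter_forall => i; apply: (@lipschitz_ae_derivable _ _ L) => s t.
  by apply: le_trans (xL s t); have := coord_le_enorm (x s - x t) i; rewrite !mxE.
move: H; apply: filterS; first exact: (ae_filter_ringOfSetsType (@lebesgue_measure R)).
by move=> t h; apply/derivable_mxP => i j; rewrite ord1; exact: h.
Qed.

Lemma abs_continuous_lipschitz (R : realType) (n : nat) (a b L : R) (f : R -> 'rV[R]_n) :
  (forall u v, enorm (f v - f u) <= L * `|v - u|) -> abs_continuous a b f.
Proof.
move=> fL e e0; have L0 : 0 < `|L| + 1 by rewrite ltr_wpDl.
exists (e / (`|L| + 1)) => [|m c d cd _ s]; first by rewrite divr_gt0.
apply: (@le_lt_trans _ _ (\sum_(i < m) (`|L| + 1) * (d i - c i))).
  apply: ler_sum => i _; have [_ cdi _] := cd i.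
  apply: le_trans (fL _ _) _; rewrite ger0_norm ?subr_ge0// ler_wpM2r ?subr_ge0//.
  by rewrite (le_trans (ler_norm L))// lerDl.
by rewrite -mulr_sumr mulrC -ltr_pdivlMr.
Qed.

Section necessity.
Context {R : realType} {n : nat}.
Context (C : R -> set 'rV[R]_n) (G : R -> 'rV[R]_n -> set 'rV[R]_n) (LC M LG : R).
Hypotheses (hC : H_C C LC) (hG : H_G G M LG).

Local Notation A := (LC + M).
Local Notation V := (LC + M + M).
Local Notation Lg := (LG * (1 + V)).

(** Dividing the integrated inequality on [[t, t + h]] by [h] shows that [g t - derive1 X t] is a
    proximal normal wherever [X] is differentiable. The last three estimates describe the start,
    where differentiability may fail. *)
Lemma solution_exists (r t0 : R) (x0 g0 : 'rV[R]_n) :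
  0 < r -> (forall t, 0 <= t -> prox_regular r (C t)) ->
  0 <= t0 -> C t0 x0 -> G t0 x0 g0 ->
  exists x : R -> 'rV[R]_n, exists2 k : R, 0 <= k &
    [/\ forall T, 0 < T -> sweeping_solution C G T t0 x0 (fun t => t0 + t) x,
    forall h, 0 <= h -> enorm (x h - x0) <= V * h,
    forall h, 0 <= h -> enorm (x0 - x h + h *: g0) <= A * h + k * h ^+ 2 &
    forall y, C t0 y -> exists2 k' : R, 0 <= k' & forall h, 0 <= h <= 1 ->
      dotv (x0 - x h + h *: g0) (y - x0) <=
      h * (A / (2 * r) * enorm (y - x0) ^+ 2 + k' * h)].
Proof.
move=> r0 Cr t00 Cx0 Gg0.
have LC0 := H_C_ge0 hC; have [M0 LG0] := H_G_ge0 hG.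
have V0 : 0 <= V by rewrite !addr_ge0.
have Lg0 : 0 <= Lg by rewrite mulr_ge0// addr_ge0.
have Ar0 : 0 <= A / (2 * r) by rewrite divr_ge0 ?addr_ge0// mulr_ge0// ltW.
have [x [g [[x00 g00] xC xL xI xII]]] := catching_up_limit hC hG r0 Cr t00 Cx0 Gg0.
have xII' s y : 0 <= s -> C (t0 + s) y -> exists2 k' : R, 0 <= k' &
    forall h, 0 <= h <= 1 -> dotv (x s - x (s + h) + h *: g s) (y - x s) <=
      h * (A / (2 * r) * enorm (y - x s) ^+ 2 + k' * h).
  move=> s0 Cy; set q := enorm (y - x s); have q0 : 0 <= q by rewrite enorm_ge0.
  have LV0 : 0 <= LC + V by rewrite addr_ge0.
  (* Expand the square in [xII] and use [h ^+ 2 <= h]. *)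
  exists (A / (2 * r) * (2 * q * (LC + V) + (LC + V) ^+ 2) + A * (LC + V) + Lg * q).
    apply: addr_ge0; last exact: mulr_ge0.
    apply: addr_ge0; last by rewrite mulr_ge0// addr_ge0.
    by apply: mulr_ge0 => //; rewrite addr_ge0 ?sqr_ge0// !mulr_ge0.
  move=> h /andP[h0 h1]; have := xII s (s + h) y s0 _ Cy.
  rewrite lerDl (_ : s + h - s = h); last by lra.
  move=> /(_ h0) /le_trans; apply.
  rewrite ler_wpM2l// -/q.
  have hh : (LC + V) ^+ 2 * h ^+ 2 <= (LC + V) ^+ 2 * h.
    by rewrite ler_wpM2l ?sqr_ge0// expr2 ler_piMl.
  have := ler_wpM2l Ar0 hh.
  move: (A / (2 * r)) (LC + V) Lg => a b l; lra.
(* Constant extension to negative times, Lipschitz on the whole line. *)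
pose X t := x (Num.max 0 t).
have maxL (s t : R) : `|Num.max 0 s - Num.max 0 t| <= `|s - t|.
  case: (leP 0 s) => s0; case: (leP 0 t) => t_0 //.
  - by rewrite subr0 !ger0_norm//; lra.
  - by rewrite sub0r normrN distrC !ger0_norm//; lra.
  - by rewrite subrr normr0.
have max0 (t : R) : 0 <= Num.max 0 t by rewrite le_max lexx.
have XL s t : enorm (X s - X t) <= V * `|s - t|.
  have : enorm (X s - X t) <= V * `|Num.max 0 s - Num.max 0 t|.
    rewrite /X; case: (leP (Num.max 0 s) (Num.max 0 t)) => st.
      rewrite edistC distrC ger0_norm ?subr_ge0//; exact: xL.
    rewrite ger0_norm ?subr_ge0 ?(ltW st)//; exact/xL/ltW.
  by move=> /le_trans; apply; rewrite ler_wpM2l.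
have XE t : 0 <= t -> X t = x t by move=> t_0; rewrite /X max_r.
have X0 : X 0 = x0 by rewrite XE.
exists X, Lg => //; split.
- move=> T T0; split => //.
  + apply: (@abs_continuous_lipschitz _ _ _ _ (1 + V)) => u v.
    rewrite tx_sub (le_trans (enorm_tx_le _ _))// mulrDl mul1r lerD//.
    by rewrite opprD addrACA subrr add0r.
  + have := lipschitz_rV_ae_derivable XL; apply: filterS.
      exact: (ae_filter_ringOfSetsType (@lebesgue_measure R)).
    move=> t dX; rewrite in_itv/= => /andP[t_0 tT].
    have did : is_derive t (1 : R) (fun t => t0 + t) (0 + 1).
      exact: is_deriveD.
    split => //; first by rewrite derive1E derive_val add0r.
    have [Cxt Gxt] := xC t t_0; rewrite XE//.
    exists (g t - derive1 X t); last by exists (g t) => //; rewrite opprB subrK.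
    split => //; exists (A / (2 * r)); split => // y Cy.
    have [k' k'0 hk'] := xII' t y t_0 Cy.
    set q := enorm (y - x t); have q0 : 0 <= q by rewrite enorm_ge0.
    apply/ler_addgt0Pr => e e0.
    have d0 : 0 < e / (2 * (q + 1)) by rewrite divr_gt0// mulr_gt0// ltr_wpDl.
    have [eta eta0 hX] := derive1_incr dX d0.
    (* The term [k' * h] and the remainder of the derivative each take half of [e]. *)
    pose h := Num.min (Num.min 1 eta) (e / (2 * (k' + 1))).
    have h0 : 0 < h.
      by rewrite !lt_min eta0 ltr01 divr_gt0// mulr_gt0// ltr_wpDl.
    have h1 : h <= 1 by rewrite !ge_min lexx.
    have heta : h <= eta by rewrite !ge_min lexx !orbT.
    have hk : k' * h <= e / 2.
      apply: (@le_trans _ _ ((k' + 1) * (e / (2 * (k' + 1))))).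
        rewrite ler_pM ?(ltW h0)//; first by rewrite lerDl.
        by rewrite ge_min lexx orbT.
      by rewrite invfM [leLHS]mulrC !mulrA divfK// gt_eqF// ltr_wpDl.
    have := hX h; rewrite (gtr0_norm h0) !XE//; last by rewrite addr_ge0// ltW.
    move=> /(_ heta); set D := x (t + h) - x t - _ => hD.
    have := hk' h; rewrite (ltW h0) h1 => /(_ isT).
    have -> : x t - x (t + h) + h *: g t = h *: (g t - derive1 X t) - D.
      by rewrite /D scalerBr; apply/rowP => j; rewrite !mxE; ring.
    rewrite dotvBl dotvZl -/q => H1.
    have H2 : dotv D (y - x t) <= h * (e / 2).
      apply: le_trans (dotv_le_enorm _ _) _.
      apply: (@le_trans _ _ (e / (2 * (q + 1)) * h * (q + 1))).
        by rewrite ler_pM// lerDl.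
      by rewrite mulrAC invfM !mulrA divfK ?gt_eqF ?ltr_wpDl// mulrC mulrA.
    have : h * dotv (g t - derive1 X t) (y - x t) <=
        h * (A / (2 * r) * q ^+ 2 + k' * h + e / 2) by lra.
    rewrite ler_pM2l//; lra.
  + move=> t; rewrite in_itv/= => /andP[t_0 _]; rewrite XE//.
    by have [] := xC t t_0.
  + by rewrite addr0.
- by move=> h h0; rewrite XE// -x00 -{2}(subr0 h); exact: xL.
- move=> h h0; rewrite XE// -x00 -g00; have := xI 0 h (lexx 0) h0.
  by rewrite subr0.
- move=> y Cy; have [|k' k'0 hk'] := xII' 0 y (lexx 0); first by rewrite addr0.
  exists k' => // h /[dup] h01 /andP[h0 _]; rewrite XE//.
  by have := hk' h h01; rewrite add0r x00 g00.
Qed.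

Context (K : set 'rV[R]_n).
Local Notation S := (graph C `&` prodset [set t : R | 0 <= t] K).

Lemma invariance_necessary : strongly_invariant C G S ->
  forall (tau : R) (x : 'rV[R]_n), S (tx tau x) ->
   forall p : 'rV[R]_(1 + n), prox_normal S (tx tau x) p ->
   exists mn mx : R,
     [/\ is_min [set dotv v p | v in prodset [set (0 : R)]
            ([set - zeta | zeta in prox_normal (C tau) x] `&`
             cball (LC + M))] mn,
         is_max [set dotv v p | v in prodset [set (1 : R)] (G tau x)] mx &
         mn + mx <= 0].
Proof.
move=> inv t0 x0 S0 p [_ [sg [sg0 pN]]].
have [p0 [q pE]] := txP p; subst p.
have [t00 Cx0 _] := (graph_prodE C K t0 x0).1 S0.
have LC0 := H_C_ge0 hC; have [M0 LG0] := H_G_ge0 hG.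
have A0 : 0 <= A by rewrite addr_ge0.
have [_ [r r0 Cr] _] := hC; have [Gc GM _] := hG.
have Ar0 : 0 <= A / (2 * r) by rewrite divr_ge0// mulr_ge0// ltW.
have [Gn0 cG _] := Gc t0 x0 t00.
have [|g0 Gg0 g0max] := @dotv_max_closed R n (G t0 x0) M q cG Gn0.
  by move=> u; exact: GM.
have [x [k k0 [sol xL xI xII]]] := solution_exists r0 Cr t00 Cx0 Gg0.
pose h m : R := mesh m.
have h0 m : 0 < h m by exact: mesh_gt0.
have h1 m : h m <= 1 by rewrite invf_le1// ler1n.
(* [g0 - zm m tt] is the mean velocity on [[0, h m]]; its limit points stand in for a derivative at
   0. *)
pose zm m (_ : unit) := (h m)^-1 *: (x0 - x (h m) + h m *: g0).
have zmE m u : h m *: zm m u = x0 - x (h m) + h m *: g0.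
  by rewrite scalerA divff ?scale1r// gt_eqF.
have zmA m u : enorm (zm m u) <= A + k * h m.
  rewrite -(ler_pM2l (h0 m)) -[X in X * enorm _](gtr0_norm (h0 m)) -enormZ zmE.
  by apply: le_trans (xI _ (ltW (h0 m))) _; lra.
have [|U [F [UP ooU FP]]] := @pointwise_ultralimit R n unit zm (fun=> A + k).
  move=> m u; apply: le_trans (zmA m u) _; rewrite lerD2l ler_piMr//.
pose zeta := F tt.
have zP : zm m tt @[m --> U] --> zeta by exact: FP.
have hP : h m @[m --> U] --> (0 : R) by apply: cvg_trans (@cvg_mesh R) => P /ooU.
have affP (a b : R) : a + b * h m @[m --> U] --> a.
  rewrite -[X in _ --> X]addr0 -(mulr0 b); apply: cvgD; first exact: cvg_cst.
  by apply: cvgM => //; exact: cvg_cst.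
have zetaA : enorm zeta <= A.
  apply: (@ler_cvg_to _ U UP R (fun m => enorm (zm m tt)) (fun m => A + k * h m)) => //.
    exact: (@cvg_enorm _ _ _ U _ (fun m => zm m tt)).
  by apply: nearW => m.
have zetaN y : C t0 y -> dotv zeta (y - x0) <= A / (2 * r) * enorm (y - x0) ^+ 2.
  move=> Cy; have [k' k'0 hk'] := xII y Cy.
  apply: (@ler_cvg_to _ U UP R (fun m => dotv (zm m tt) (y - x0))
    (fun m => A / (2 * r) * enorm (y - x0) ^+ 2 + k' * h m)) => //.
    by apply: (@cvg_dotv _ _ _ U _ (fun m => zm m tt)) => //; exact: cvg_cst.
  apply: nearW => m; rewrite -(ler_pM2l (h0 m)) -dotvZl zmE.
  by apply: hk'; rewrite (ltW (h0 m)) h1.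
have zetap : p0 + dotv (g0 - zeta) q <= 0.
  apply: (@ler_cvg_to _ U UP R (fun m => p0 + dotv (g0 - zm m tt) q)
    (fun m => 0 + sg * (1 + V ^+ 2) * h m)) => //.
    apply: cvgD; first exact: cvg_cst.
    apply: (@cvg_dotv _ _ _ U _ (fun m => g0 - zm m tt)); last exact: cvg_cst.
    by apply: cvgB => //; exact: cvg_cst.
  apply: nearW => m; rewrite add0r -(ler_pM2l (h0 m)).
  have hin : h m \in `[0, 1] by rewrite in_itv/= (ltW (h0 m)) h1.
  (* Invariance makes the solution at time [h m] a test point; the right-hand side is quadratic in
     [h m] and vanishes after division. *)
  have := pN _ (inv _ _ S0 _ ltr01 _ _ (sol _ ltr01) _ hin).
  rewrite tx_sub dotv_tx sqr_enorm_tx (_ : t0 + h m - t0 = h m); last by lra.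
  have -> : dotv q (x (h m) - x0) = h m * dotv (g0 - zm m tt) q.
    rewrite -dotvZl scalerBr zmE dotvC; congr dotv.
    by apply/rowP => j; rewrite !mxE; ring.
  have : enorm (x (h m) - x0) ^+ 2 <= (V * h m) ^+ 2.
    rewrite ler_pXn2r ?nnegrE ?mulr_ge0 ?(ltW (h0 m)) ?addr_ge0//.
    exact/xL/ltW.
  move=> /(ler_wpM2l sg0); rewrite exprMn; lra.
(* The opposites of the admissible normals, described with the uniform constant [A / (2 * r)] given
   by prox-regularity. This form is visibly closed, so the minimum is attained. *)
pose D := [set v : 'rV[R]_n | enorm v <= A /\ forall y, C t0 y ->
  dotv (- v) (y - x0) <= A / (2 * r) * enorm (y - x0) ^+ 2].
have DN v : D v -> prox_normal (C t0) x0 (- v).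
  by move=> [_ vN]; split => //; exists (A / (2 * r)); split.
have ND z : prox_normal (C t0) x0 z -> enorm z <= A -> D (- z).
  move=> Nz zA; split; first by rewrite enormN.
  by move=> y Cy; rewrite opprK; exact: prox_regular_le r0 (Cr _ t00) Nz zA Cy.
have cD : closed D.
  apply/closed_enormP => v hv; split.
    apply/ler_addgt0Pr => e /hv[u [uA _] vu].
    by rewrite -(subrK u v) addrC (le_trans (ler_enormD _ _))// lerD// ltW.
  move=> y Cy; apply/ler_addgt0Pr => e e0.
  have d0 : 0 < e / (enorm (y - x0) + 1) by rewrite divr_gt0// ltr_wpDl.
  have [u [_ uN] vu] := hv _ d0.
  have -> : - v = - u - (v - u) by apply/rowP => j; rewrite !mxE; ring.
  rewrite dotvBl lerD// ?uN// lerNl.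
  have := normr_dotv_le (v - u) (y - x0); rewrite ler_norml => /andP[+ _].
  apply: le_trans; rewrite lerN2.
  apply: (@le_trans _ _ (e / (enorm (y - x0) + 1) * (enorm (y - x0) + 1))).
    by rewrite ler_pM// ?lerDl// ltW.
  by rewrite divfK// gt_eqF// ltr_wpDl.
have zetaD : D (- zeta) by split; [rewrite enormN|move=> y; rewrite opprK; exact: zetaN].
have [||z Dz zmax] := @dotv_max_closed R n D A (- q) cD.
- by exists (- zeta).
- by move=> u [].
have txp v t : dotv (tx t v) (tx p0 q) = t * p0 + dotv v q by rewrite dotv_tx.
exists (dotv (tx 0 z) (tx p0 q)), (dotv (tx 1 g0) (tx p0 q)); split.
- split.
    exists (tx 0 z) => //; exists 0 => //; exists z => //.
    by split; [exists (- z); [exact: DN|rewrite opprK]|have [] := Dz].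
  move=> _ [_ [_ -> [w [[z' Nz' <-] zA] <-]] <-].
  rewrite !txp !mul0r !add0r -lerN2 -!dotvNr; apply: zmax.
  by apply: ND => //; rewrite -enormN.
- split; first by exists (tx 1 g0) => //; exists 1 => //; exists g0.
  by move=> _ [_ [_ -> [w Gw <-]] <-]; rewrite !txp lerD2l; exact: g0max.
- have := zmax _ zetaD; rewrite !txp !dotvNr !dotvNl.
  move: zetap; rewrite dotvBl; lra.
Qed.

End necessity.

Theorem theorem4p4 (R : realType) (n : nat) (C : R -> set 'rV[R]_n)
    (G : R -> 'rV[R]_n -> set 'rV[R]_n) (LC M LG : R) (K : set 'rV[R]_n)
    (hC : H_C C LC) (hG : H_G G M LG) (hK : closed K)
    (hCK : forall t : R, 0 <= t -> C t `&` K !=set0) :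
  let KK := prodset [set t : R | 0 <= t] K in
  strongly_invariant C G (graph C `&` KK) <->
  (forall (tau : R) (x : 'rV[R]_n), (graph C `&` KK) (tx tau x) ->
   forall p : 'rV[R]_(1 + n), prox_normal (graph C `&` KK) (tx tau x) p ->
   exists mn mx : R,
     [/\ is_min [set dotv v p | v in prodset [set (0 : R)]
            ([set - zeta | zeta in prox_normal (C tau) x] `&`
             cball (LC + M))] mn,
         is_max [set dotv v p | v in prodset [set (1 : R)] (G tau x)] mx &
         mn + mx <= 0]).
Proof.
move=> KK; split=> [inv tau x|cond]; first exact: (invariance_necessary hC hG inv).
exact: (invariance_sufficient hC hG hK cond).
Qed.
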